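(* Up to rigid transformations of the plane, there are exactly two distinct convex arithmetic polygons.
   Context: An arithmetic polygon is a (closed) polygon in the plane with integer side lengths and a distinguished vertex $O$ satisfying: (1) as one traverses the polygon starting and finishing at $O$, each side has length exactly one greater than the length of the side preceding it; (2) for each side of the polygon, there is a line perpendicular to that side which passes through both $O$ and one of the two endpoints of that side; (3) no vertex is degenerate, i.e., no vertex has an angle of $0$ or $\pi$ radians. A polygon is convex if it is a simple polygon all of whose interior angles are less than $\pi$. *)

(* Defs.v *)
From HB Require Import structures.
From mathcomp Require Import all_boot all_order all_algebra.
From mathcomp Require Import all_classical all_reals all_analysis.
Set Implicit Arguments.
Unset Strict Implicit.
Unset Printing Implicit Defensive.
Import Order.TTheory GRing.Theory Num.Theory.
Import numFieldNormedType.Exports.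
Local Open Scope classical_set_scope.
Local Open Scope ring_scope.

Section Plane.
Context {R : realType}.
Notation point := 'rV[R]_2.
Implicit Types (p q r u v d : point) (s : seq point) (i j : nat).

Definition edot u v : R := \sum_(k < 2) u 0 k * v 0 k.

(* The library norm `|u| on row vectors is the sup norm; lengths and angles
   need the Euclidean one. *)
Definition enorm u : R := Num.sqrt (edot u u).

Definition segment p q : set point :=
  [set (1 - t) *: p + t *: q | t in `[0, 1]].

Definition line p d : set point := [set p + t *: d | t in setT].

(* The unoriented angle pqr, in [0, pi] (for p, r distinct from q). *)
Definition angle p q r : R :=
  acos (edot (p - q) (r - q) / (enorm (p - q) * enorm (r - q))).

Definition unit_vec u : point := (enorm u)^-1 *: u.

(* A polygon with a distinguished vertex O is the list of its vertices in the
   order of traversal, starting at O.  Indices are read cyclically. *)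
Definition vertex s i : point := s`_(i %% size s)%N.

Definition prev_vertex s i : point := vertex s (i + (size s).-1)%N.

Definition polygon s : Prop :=
  (2 < size s)%N /\ forall i, vertex s i != vertex s i.+1.

Definition side s i : set point := segment (vertex s i) (vertex s i.+1).

Definition side_length s i : R := enorm (vertex s i.+1 - vertex s i).

Definition vertex_angle s i : R :=
  angle (prev_vertex s i) (vertex s i) (vertex s i.+1).

Definition boundary s : set point := \bigcup_(i in `I_(size s)) side s i.

Definition simple_polygon s : Prop :=
  (forall i, (i < size s)%N -> side s i `&` side s i.+1 = [set vertex s i.+1])
  /\ (forall i j, (i < size s)%N -> (j < size s)%N -> i != j ->
        i != (j.+1 %% size s)%N -> j != (i.+1 %% size s)%N ->
        side s i `&` side s j = set0).

(* The bounded part of the complement of the polygon (Jordan). *)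
Definition inside s : set point :=
  [set x | (~` boundary s) x /\
           bounded_set (connected_component (~` boundary s) x)].

(* The two sides at a vertex cut a small disc into two sectors, of angles
   a = vertex_angle and 2 pi - a; the interior angle is that of the sector
   lying inside the polygon.  The sector of angle a (when 0 < a < pi) is the one
   containing the bisector of the two sides.  If a = pi the bisecting vector is
   0, so the test fails and the value is 2 pi - pi = pi, as it should be. *)
Definition interior_angle s i : R :=
  let b := unit_vec (prev_vertex s i - vertex s i)
         + unit_vec (vertex s i.+1 - vertex s i) in
  if `[< \forall e \near 0^'+, inside s (vertex s i + e *: b) >]
  then vertex_angle s i else 2 * pi - vertex_angle s i.

Definition convex_polygon s : Prop :=
  [/\ polygon s, simple_polygon s &
      forall i, (i < size s)%N -> interior_angle s i < pi].

Definition arithmetic_polygon s : Prop :=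
  let O := vertex s 0 in
  [/\ polygon s,
      forall i, (i < size s)%N -> side_length s i \is a Num.int,
      forall i, (i.+1 < size s)%N -> side_length s i.+1 = side_length s i + 1,
      forall i, (i < size s)%N ->
        exists p d, [/\ d != 0, edot d (vertex s i.+1 - vertex s i) = 0,
          line p d O &
          line p d (vertex s i) \/ line p d (vertex s i.+1)] &
      forall i, (i < size s)%N -> vertex_angle s i != 0 /\ vertex_angle s i != pi].

Definition convex_arithmetic_polygon s : Prop :=
  arithmetic_polygon s /\ convex_polygon s.

(* Rigid transformations are all isometries of the plane, reflections
   included. *)
Definition rigid (f : point -> point) : Prop :=
  forall p q, enorm (f p - f q) = enorm (p - q).

Definition congruent s1 s2 : Prop :=
  exists2 f : point -> point, rigid f & map f s1 = s2.

End Plane.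

(* Main.v *)
(* With O as origin, condition (2) says that each triangle O v_i v_{i+1} has a right
   angle at v_i or at v_{i+1}, so |v_i|^2 changes by plus or minus the square of
   the side length.  Non-degeneracy forbids a minus followed by a plus, hence the
   first k side lengths a, a+1, ... and the remaining ones have the same sum of
   squares.  In a convex polygon all triangles turn the same way around O and the
   total angle at O is at most pi; since the i-th triangle contributes at least
   arctan (1 / sqrt i), this forces k <= 6.  The equation on sums of squares then
   leaves 3^2+4^2 = 5^2, 10^2+11^2+12^2 = 13^2+14^2 and three larger solutions
   whose total angle exceeds pi.

   Convexity is given through interior angles, that is, through the bounded
   components of the complement.  In a simple polygon the points near a boundary
   point that belong to a given union of components accumulate at all the nearby
   boundary points, so the closure of such a union contains all of the boundary
   as soon as it meets it.  As the small sector at each vertex is inside, the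
   large one is outside, and every side is locally one-sided.  As in Tietze's
   theorem, a component of the inside is then convex, and the whole polygon lies
   on one side of each of its sides. *)

Require Import Defs.
From mathcomp Require Import all_boot all_order all_algebra.
From mathcomp Require Import all_classical all_reals all_analysis.
From mathcomp Require Import ring lra zify.

Set Implicit Arguments.
Unset Strict Implicit.
Unset Printing Implicit Defensive.
Import Order.TTheory GRing.Theory Num.Theory.
Import numFieldNormedType.Exports.
Local Open Scope classical_set_scope.
Local Open Scope ring_scope.

(** * Dot and cross products in the plane, segments and closures *)

Section PlaneGeometry.
Context {R : realType}.
Implicit Types (p q u w x y z : 'rV[R]_2) (A W : set 'rV[R]_2).

Definition cross u w : R := u 0 0 * w 0 1 - u 0 1 * w 0 0.

Lemma edotE u w : edot u w = u 0 0 * w 0 0 + u 0 1 * w 0 1.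
Proof.
rewrite /edot !big_ord_recl big_ord0 addr0.
by congr (_ + u 0 _ * w 0 _); apply: val_inj.
Qed.

Lemma rV2P u w : u 0 0 = w 0 0 -> u 0 1 = w 0 1 -> u = w.
Proof.
move=> h0 h1; apply/rowP => j.
have [->|->] // : j = 0 \/ j = 1.
by case: j => [[|[|?]]] //= ?; [left|right]; apply: val_inj.
Qed.

Lemma crossC u w : cross u w = - cross w u.
Proof. by rewrite /cross; ring. Qed.

Lemma crossvv u : cross u u = 0.
Proof. by rewrite /cross; ring. Qed.

Lemma crossDr u w1 w2 : cross u (w1 + w2) = cross u w1 + cross u w2.
Proof. by rewrite /cross !mxE; ring. Qed.

Lemma crossNr u w : cross u (- w) = - cross u w.
Proof. by rewrite /cross !mxE; ring. Qed.

Lemma crossZr a u w : cross u (a *: w) = a * cross u w.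
Proof. by rewrite /cross !mxE; ring. Qed.

Lemma crossDl u1 u2 w : cross (u1 + u2) w = cross u1 w + cross u2 w.
Proof. by rewrite /cross !mxE; ring. Qed.

Lemma crossNl u w : cross (- u) w = - cross u w.
Proof. by rewrite /cross !mxE; ring. Qed.

Lemma crossZl a u w : cross (a *: u) w = a * cross u w.
Proof. by rewrite /cross !mxE; ring. Qed.

Lemma Lagrange_identity u w :
  cross u w ^+ 2 + edot u w ^+ 2 = edot u u * edot w w.
Proof. by rewrite !edotE /cross; ring. Qed.

Lemma edot_ge0 u : 0 <= edot u u.
Proof. by rewrite edotE -!expr2 addr_ge0 ?sqr_ge0. Qed.

Lemma edot_eq0 u : (edot u u == 0) = (u == 0).
Proof.
apply/eqP/eqP => [|->]; last by rewrite edotE !mxE mulr0 addr0.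
rewrite edotE -!expr2 => /eqP; rewrite paddr_eq0 ?sqr_ge0// !sqrf_eq0.
by move=> /andP[/eqP h0 /eqP h1]; apply: rV2P; rewrite !mxE.
Qed.

Lemma edot_gt0 u : u != 0 -> 0 < edot u u.
Proof. by rewrite lt0r edot_ge0 edot_eq0 => ->. Qed.

Lemma enorm_gt0 u : u != 0 -> 0 < enorm u.
Proof. by move=> /edot_gt0; rewrite /enorm sqrtr_gt0. Qed.

Lemma sqr_enorm u : enorm u ^+ 2 = edot u u.
Proof. by rewrite /enorm sqr_sqrtr ?edot_ge0. Qed.

Lemma cross_eq0 u w : u != 0 -> cross u w = 0 -> exists t, w = t *: u.
Proof.
move=> u0 uw; exists (edot u w / edot u u).
have uu0 : edot u u != 0 by rewrite edot_eq0.
move: uu0 uw; rewrite !edotE /cross => uu0 uw.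
apply: rV2P; rewrite !mxE mulrAC; apply: (mulIf uu0); rewrite divfK //.
  transitivity ((u 0 0 * w 0 0 + u 0 1 * w 0 1) * u 0 0
    - u 0 1 * (u 0 0 * w 0 1 - u 0 1 * w 0 0)); last by rewrite uw; ring.
  by ring.
transitivity ((u 0 0 * w 0 0 + u 0 1 * w 0 1) * u 0 1
  + u 0 0 * (u 0 0 * w 0 1 - u 0 1 * w 0 0)); last by rewrite uw; ring.
by ring.
Qed.

(** This is Cramer's rule in the basis [w], [u]. *)
Lemma cross_decomposition u w x : cross u w != 0 ->
  x = (cross u x / cross u w) *: w - (cross w x / cross u w) *: u.
Proof. by rewrite /cross => uw; apply: rV2P; rewrite !mxE; field. Qed.

Lemma coord_le_norm u j : `|u 0 j| <= `|u|.
Proof.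

by rewrite [`|u|]/Num.norm/= mx_normrE; apply: (le_bigmax _ _ (0, j)).
Qed.

(** Each of the two products in the determinant is bounded for the sup norm, whence the factor 2;
    only Lipschitz continuity matters later. *)
Lemma cross_le_norm u w : `|cross u w| <= (2 * `|u|) * `|w|.
Proof.
have := coord_le_norm u 0; have := coord_le_norm u 1.
have := coord_le_norm w 0; have := coord_le_norm w 1.
rewrite /cross => h1 h2 h3 h4.
apply: (le_trans (ler_normB _ _)); rewrite !normrM.
have -> : 2 * `|u| * `|w| = `|u| * `|w| + `|u| * `|w| by ring.
by apply: lerD; apply: ler_pM.
Qed.

Lemma segment_left p q : segment p q p.
Proof.
exists 0; first by rewrite /= in_itv/= lexx ler01.
by rewrite subr0 scale1r scale0r addr0.
Qed.

Lemma segment_right p q : segment p q q.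
Proof.
exists 1; first by rewrite /= in_itv/= lexx ler01.
by rewrite subrr scale1r scale0r add0r.
Qed.

Lemma segment_sym p q : segment p q = segment q p.
Proof.
rewrite predeqE => x; split=> -[t]; rewrite /= in_itv/= => /andP[t0 t1] <-;
  by exists (1 - t); [rewrite /= in_itv/=; lra | rewrite opprB addrC subrKC].
Qed.

Lemma continuous_segment p q :
  continuous (fun t : R => (1 - t) *: p + t *: q).
Proof.
rewrite (_ : (fun t => _) = (fun t => p + t *: (q - p))); last first.
  by apply/funext => t; apply/rowP => j; rewrite !mxE; ring.
by move=> t; apply: cvgD; [exact: cvg_cst|exact: scalel_continuous].
Qed.

Lemma connected_seg p q : connected (segment p q).
Proof.
apply: connected_continuous_connected; first exact: segment_connected.
exact/continuous_subspaceT/continuous_segment.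
Qed.

Lemma closed_seg p q : closed (segment p q).
Proof.
apply: compact_closed; first exact: norm_hausdorff.
apply: continuous_compact; last exact: segment_compact.
exact/continuous_subspaceT/continuous_segment.
Qed.

Lemma cross_segment u w p q t :
  cross u ((1 - t) *: p + t *: q - w) =
  (1 - t) * cross u (p - w) + t * cross u (q - w).
Proof. by rewrite /cross !mxE; ring. Qed.

Lemma closure_normP A z :
  closure A z <-> forall e, 0 < e -> exists2 w, A w & `|z - w| < e.
Proof.
split=> [cA e e0|h B /nbhs_ballP[e /= e0 eB]].
  have [w [Aw zw]] := cA _ (nbhsx_ballx z e e0).
  by exists w => //; move: zw; rewrite -ball_normE.
have [w Aw zw] := h e e0; exists w; split=> //; apply: eB.
by rewrite -ball_normE.
Qed.

Lemma norm_seg_lt z x y e t : 0 <= t <= 1 -> `|z - x| < e -> `|z - y| < e ->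
  `|z - ((1 - t) *: x + t *: y)| < e.
Proof.
move=> /andP[t0 t1] zx zy.
have -> : z - ((1 - t) *: x + t *: y) = (1 - t) *: (z - x) + t *: (z - y).
  by apply/rowP => j; rewrite !mxE; ring.
apply: (le_lt_trans (ler_normD _ _)).
rewrite !normrZ !ger0_norm ?subr_ge0//.
have [->|tn0] := eqVneq t 0; first by rewrite subr0 mul1r mul0r addr0.
have t0' : 0 < t by rewrite lt0r tn0.
have : t * `|z - y| < t * e by rewrite ltr_pM2l.
have : (1 - t) * `|z - x| <= (1 - t) * e by rewrite ler_wpM2l ?subr_ge0// ltW.
by lra.
Qed.

End PlaneGeometry.

(** * Sides as affine functions, with cyclic indices *)

Section PolygonIndexing.
Context {R : realType} (s : seq 'rV[R]_2).
Implicit Types (x y z : 'rV[R]_2) (i j : nat).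

Definition edge i : 'rV[R]_2 := vertex s i.+1 - vertex s i.

(** Twice the signed area of the triangle on side [i] with apex [x]: an affine function that
    vanishes on the line of the side and is positive to its left. *)
Definition edge_side i x : R := cross (edge i) (x - vertex s i).

(** The sense of rotation at vertex [i.+1], not at vertex [i]. *)
Definition turn i : R := cross (edge i) (edge i.+1).

Lemma vertex_mod i : vertex s (i %% size s)%N = vertex s i.
Proof. by rewrite /vertex modn_mod. Qed.

Lemma vertexS_mod i : vertex s (i %% size s).+1 = vertex s i.+1.
Proof. by rewrite /vertex -[(i %% _).+1]addn1 modnDml addn1. Qed.

Lemma vertex_size i : vertex s (i + size s) = vertex s i.
Proof. by rewrite /vertex modnDr. Qed.

Lemma prev_vertexS i : (0 < size s)%N -> prev_vertex s i.+1 = vertex s i.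
Proof.
by move=> n0; rewrite /prev_vertex addSnnS prednK// vertex_size.
Qed.

Lemma side_mod i : side s (i %% size s)%N = side s i.
Proof. by rewrite /side vertex_mod vertexS_mod. Qed.

Lemma eq_side i j : i = j %[mod size s] -> side s i = side s j.
Proof. by move=> ij; rewrite -side_mod ij side_mod. Qed.

Lemma side_boundary i : (0 < size s)%N -> side s i `<=` boundary s.
Proof. by move=> n0 x; exists (i %% size s)%N; rewrite /= ?ltn_mod ?side_mod. Qed.

Lemma side_left i : side s i (vertex s i).
Proof. exact: segment_left. Qed.

Lemma side_right i : side s i (vertex s i.+1).
Proof. exact: segment_right. Qed.

Lemma sideP i x : side s i x ->
  exists2 t, 0 <= t <= 1 & x = vertex s i + t *: edge i.
Proof.
move=> [t]; rewrite /= in_itv/= => t01 <-; exists t => //.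
by apply/rowP => k; rewrite /edge !mxE; ring.
Qed.

Lemma in_side i t : 0 <= t <= 1 -> side s i (vertex s i + t *: edge i).
Proof.
move=> t01; exists t => //=.
by apply/rowP => k; rewrite /edge !mxE; ring.
Qed.

Lemma edge_side_on i x : side s i x -> edge_side i x = 0.
Proof.
by move=> /sideP[t _ ->]; rewrite /edge_side addrAC subrr add0r crossZr crossvv mulr0.
Qed.

Lemma edge_sideD i x y : edge_side i (x + y) = edge_side i x + cross (edge i) y.
Proof. by rewrite /edge_side /cross !mxE; ring. Qed.

Lemma edge_side_vertex i : edge_side i (vertex s i) = 0.
Proof. exact/edge_side_on/side_left. Qed.

Lemma edge_side_vertexS i : edge_side i (vertex s i.+1) = 0.
Proof. exact/edge_side_on/side_right. Qed.

Lemma edge_side_segment i x y t : edge_side i ((1 - t) *: x + t *: y) =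
  (1 - t) * edge_side i x + t * edge_side i y.
Proof. exact: cross_segment. Qed.

Lemma edge_sideS2 i : edge_side i (vertex s i.+2) = turn i.
Proof.
rewrite -(subrK (vertex s i.+1) (vertex s i.+2)) addrC edge_sideD.
by rewrite edge_side_vertexS add0r.
Qed.

Lemma edge_sideS_vertex i : edge_side i.+1 (vertex s i) = turn i.
Proof.
by rewrite /turn crossC -crossNr /edge_side /(edge i) opprB.
Qed.

Lemma edge_side_lipschitz i x y :
  `|edge_side i x - edge_side i y| <= (2 * `|edge i|) * `|x - y|.
Proof.
have -> : edge_side i x - edge_side i y = cross (edge i) (x - y).
  by rewrite /edge_side -crossNr -crossDr opprB addrA subrK.
exact: cross_le_norm.
Qed.

(** Lipschitz continuity carries the weak sign to limits; the factor [d] stands for an orientation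
    not yet known. *)
Lemma edge_side_closure (A : set 'rV[R]_2) i d z : closure A z ->
  (forall x, A x -> 0 <= d * edge_side i x) -> 0 <= d * edge_side i z.
Proof.
move=> cAz Age0; rewrite leNgt; apply/negP => neg.
have M0 : 0 < `|d| * (2 * `|edge i|) + 1 by rewrite ltr_wpDl// !mulr_ge0.
have r0 : 0 < - (d * edge_side i z) / (`|d| * (2 * `|edge i|) + 1).
  by rewrite divr_gt0// oppr_gt0.
have [u Au] := (closure_normP _ _).1 cAz _ r0.
rewrite ltr_pdivlMr// => zu.
have : `|d * (edge_side i u - edge_side i z)| <= `|d| * (2 * `|edge i|) * `|z - u|.
  by rewrite normrM -mulrA ler_wpM2l// (distrC z) edge_side_lipschitz.
move=> /ler_normlW; rewrite mulrBr; have := Age0 _ Au; have := normr_ge0 (z - u).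
by lra.
Qed.

Lemma prev_vertex_mod i : prev_vertex s (i %% size s)%N = prev_vertex s i.
Proof. by rewrite /prev_vertex /vertex modnDml. Qed.

Lemma vertex_angleS i : (0 < size s)%N -> vertex_angle s (i.+1 %% size s)%N =
  angle (vertex s i) (vertex s i.+1) (vertex s i.+2).
Proof.
move=> n0.
by rewrite /vertex_angle prev_vertex_mod prev_vertexS// vertex_mod vertexS_mod.
Qed.

Lemma edge_side_mod i x : edge_side (i %% size s)%N x = edge_side i x.
Proof. by rewrite /edge_side /edge vertex_mod vertexS_mod. Qed.

End PolygonIndexing.

(** * Which sides of a simple polygon share a point *)

Section SimplePolygons.
Context {R : realType} (s : seq 'rV[R]_2).
Context (polS : polygon s) (simS : simple_polygon s).
Implicit Types (x y z : 'rV[R]_2) (i j : nat).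

Let n := size s.
Let v := vertex s.

Lemma size_polygon_gt0 : (0 < n)%N.
Proof. by case: polS => /ltnW/ltnW. Qed.
Let n0 := size_polygon_gt0.

Lemma polygon_edge_neq0 i : edge s i != 0.
Proof. by rewrite /edge subr_eq0 eq_sym; case: polS. Qed.

Lemma side_adjacent i x : side s i x -> side s i.+1 x -> x = v i.+1.
Proof.
move=> six sSx; have [/(_ (i %% n)%N) + _] := simS.
rewrite ltn_mod n0 side_mod vertexS_mod => /(_ isT) E.
suff : (side s i `&` side s (i %% n).+1) x by rewrite E.
split=> //; rewrite (_ : side _ _ = side s i.+1)//; apply: eq_side.
by rewrite -[(i %% n).+1]addn1 modnDml addn1.
Qed.

Lemma side_meet i j x : side s i x -> side s j x ->
  [\/ i = j %[mod n], i = j.+1 %[mod n] | j = i.+1 %[mod n]].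
Proof.
move=> six sjx; have [//|ij] := eqVneq (i %% n)%N (j %% n)%N; first by constructor 1.
have [|ijS] := eqVneq (i %% n)%N (j.+1 %% n)%N; first by constructor 2.
have [|jiS] := eqVneq (j %% n)%N (i.+1 %% n)%N; first by constructor 3.
have [_ /(_ (i %% n) (j %% n))%N] := simS; rewrite !ltn_mod n0.
rewrite -[(j %% n).+1]addn1 -[(i %% n).+1]addn1 !modnDml !addn1.
move=> /(_ isT isT ij ijS jiS); rewrite !side_mod => E.
by have : (side s i `&` side s j) x by []; rewrite E.
Qed.

(** A neighbouring side meets this one only at a common endpoint. The index is a successor so that
    the preceding side can be named without subtraction; the same device recurs below. *)
Lemma side_interior_only i j x : side s i.+1 x -> x != v i.+1 -> x != v i.+2 ->
  side s j x -> j = i.+1 %[mod n].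
Proof.
move=> six xv xv' sjx; have [//|iSj|jiS] := side_meet six sjx.
- have ij : i = j %[mod n].
    by apply/eqP; rewrite -(eqn_modDr 1) !addn1; exact/eqP.
  have /(side_adjacent)/(_ six) E : side s i x by rewrite (eq_side ij).
  by rewrite E eqxx in xv.
- rewrite (eq_side jiS) in sjx.
  by have E := side_adjacent six sjx; rewrite E eqxx in xv'.
Qed.

Lemma vertex_side i j : side s j (v i.+1) ->
  j = i %[mod n] \/ j = i.+1 %[mod n].
Proof.
move=> sj; have [/esym ?|iSj|jiS] := side_meet (side_left s i.+1) sj.
- by right.
- by left; apply/eqP; rewrite eq_sym -(eqn_modDr 1) !addn1; exact/eqP.
- rewrite (eq_side jiS) in sj.
  have E := side_adjacent (side_left s i.+1) sj.
  by have [_ /(_ i.+1)/eqP[]] := polS.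
Qed.

(* Only finitely many sides avoid z, and each of them is closed. *)
Lemma boundary_near (J : pred nat) z :
  (forall j, (j < n)%N -> side s j z -> J j) ->
  exists2 e, 0 < e & forall x, `|z - x| < e -> boundary s x ->
    exists2 j, J j & side s j x.
Proof.
move=> zJ; pose F := \bigcup_(j in [set j | (j < n)%N && ~~ J j]) side s j.
have clF : closed F.
  apply: closed_bigcup => [|j _]; last exact: closed_seg.
  by apply: (@sub_finite_set _ _ `I_n) => [j /andP[]|] //; exact: finite_II.
have /open_nbhs_nbhs : open_nbhs z (~` F).
  split; first exact: closed_openC.
  by move=> [j /andP[jn Jj] sj]; rewrite (zJ j) in Jj.
move=> /nbhs_ballP[e /= e0 eF]; exists e => // x zx [j /= jn sj].
exists j => //; apply: contrapT => /negP Jj.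
by apply: (eF x); [rewrite -ball_normE|exists j => //=; rewrite jn].
Qed.

End SimplePolygons.

(** * Signs of convex combinations *)

Lemma conv_gt0 {R : realDomainType} (a b t : R) : 0 <= t <= 1 -> 0 < a -> 0 < b ->
  0 < (1 - t) * a + t * b.
Proof.
move=> /andP[t0 t1] a0 b0; have [->|tn0] := eqVneq t 0.
  by rewrite subr0 mul1r mul0r addr0.
apply: ltr_wpDl; first by rewrite mulr_ge0 ?subr_ge0// ltW.
by rewrite mulr_gt0// lt0r tn0.
Qed.

Lemma conv_lt0 {R : realDomainType} (a b t : R) : 0 <= t <= 1 -> a < 0 -> b < 0 ->
  (1 - t) * a + t * b < 0.
Proof.
rewrite -oppr_gt0 -(oppr_gt0 b) -oppr_gt0 opprD -!mulrN => t01.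
exact: conv_gt0.
Qed.

Lemma conv_pgt0 {R : realDomainType} (a b t : R) : 0 < t <= 1 -> 0 <= a -> 0 < b ->
  0 < (1 - t) * a + t * b.
Proof.
move=> /andP[t0 t1] a0 b0.
by rewrite ltr_wpDl ?mulr_ge0 ?subr_ge0// mulr_gt0.
Qed.

Lemma conv_neq0 {R : realDomainType} (a b t : R) : 0 <= t <= 1 -> 0 < a * b ->
  (1 - t) * a + t * b != 0.
Proof.
move=> t01 ab; have a0 : a != 0 by apply: contraTneq ab => ->; rewrite mul0r ltxx.
have aa : 0 < a * a by rewrite -expr2 exprn_even_gt0//= a0.
have := conv_gt0 t01 aa ab.
rewrite (_ : _ + _ = a * ((1 - t) * a + t * b)); last by ring.
by apply: contraTneq => ->; rewrite mulr0 ltxx.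
Qed.

(** * Shape of the boundary near its points, and unions of components *)

Section LocalStructure.
Context {R : realType} (s : seq 'rV[R]_2).
Context (polS : polygon s) (simS : simple_polygon s).
Context (turnS : forall i, turn s i != 0).
Implicit Types (x y z w : 'rV[R]_2) (W : set 'rV[R]_2) (i j : nat) (e : R).

Let n := size s.
Let v := vertex s.
Let n0 : (0 < n)%N := size_polygon_gt0 polS.
Let edge0 i : edge s i != 0 := polygon_edge_neq0 polS i.

Lemma edge_side_eq0 i x : edge_side s i x = 0 ->
  exists t, x = vertex s i + t *: edge s i.
Proof.
by move=> /(cross_eq0 (edge0 i))[t xE]; exists t; rewrite -xE subrKC.
Qed.

Lemma boundary_near_side i z :
  side s i.+1 z -> z != vertex s i.+1 -> z != vertex s i.+2 ->
  exists2 e, 0 < e & forall x, `|z - x| < e ->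
    (boundary s x <-> edge_side s i.+1 x = 0).
Proof.
move=> sz zv zv'.
have [j jn sj|e1 e10 He1] := @boundary_near _ s (fun j => j == i.+1 %[mod n]) z.
  exact/eqP/(side_interior_only polS simS sz).
have [t /andP[t0 t1] zE] := sideP sz.
have tn0 : 0 < t.
  by rewrite lt0r t0 andbT; apply: contraNneq zv => th; rewrite zE th scale0r addr0.
have tn1 : t < 1.
  rewrite lt_neqAle t1 andbT; apply: contraNneq zv' => th.
  by rewrite zE th scale1r /edge subrKC.
have a0 : 0 < `|edge s i.+1| by rewrite normr_gt0.
(* The first radius leaves only one side nearby; the second keeps points of its line from running
   past the endpoints. *)
exists (Num.min e1 (Num.min t (1 - t) * `|edge s i.+1|)).
  by rewrite lt_min e10 mulr_gt0// lt_min tn0 subr_gt0.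
move=> x; rewrite lt_min => /andP[zx1 zx2]; split.
  move=> /(He1 _ zx1)[j /eqP jE]; rewrite (eq_side jE) => sx.
  exact: edge_side_on.
move=> /edge_side_eq0[r xE]; apply: (side_boundary n0 (i := i.+1)).
rewrite xE; apply: in_side; move: zx2.
have -> : z - x = (t - r) *: edge s i.+1.
  by rewrite xE zE; apply/rowP => k; rewrite !mxE; ring.
by rewrite normrZ ltr_pM2r// lt_min !ltr_norml; lra.
Qed.

(* Near a vertex, the boundary is the boundary of the convex sector bounded by
   the two adjacent sides. *)
Definition vertex_chart i e := forall x, `|vertex s i.+1 - x| < e ->
    (boundary s x <-> [/\ 0 <= turn s i * edge_side s i x,
      0 <= turn s i * edge_side s i.+1 x &
      edge_side s i x * edge_side s i.+1 x = 0]).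

Lemma boundary_near_vertex i :
  exists2 e, 0 < e & vertex_chart i e.
Proof.
have [j jn sj|e1 e10 He1] := @boundary_near _ s
    (fun j => (j == i %[mod n]) || (j == i.+1 %[mod n])) (v i.+1).
  by have [->|->] := vertex_side polS simS sj; rewrite eqxx ?orbT.
have a0 : 0 < `|edge s i| by rewrite normr_gt0.
have a1 : 0 < `|edge s i.+1| by rewrite normr_gt0.
(* Along the line of one side, the affine function of the other vanishes only at the vertex, so its
   sign tells the two half-lines apart. *)
have onl t : edge_side s i.+1 (vertex s i + t *: edge s i) = (1 - t) * turn s i.
  rewrite edge_sideD edge_sideS_vertex crossZr (crossC (edge s i.+1)) -/(turn s i).
  by ring.
have onr t : edge_side s i (vertex s i.+1 + t *: edge s i.+1) = t * turn s i.
  by rewrite edge_sideD edge_side_vertexS crossZr add0r.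
have onl0 t : edge_side s i (vertex s i + t *: edge s i) = 0.
  by rewrite edge_sideD edge_side_vertex crossZr crossvv; ring.
have onr0 t : edge_side s i.+1 (vertex s i.+1 + t *: edge s i.+1) = 0.
  by rewrite edge_sideD edge_side_vertex crossZr crossvv; ring.
have t2 : 0 < turn s i * turn s i by rewrite -expr2 exprn_even_gt0//= turnS.
exists (Num.min e1 (Num.min `|edge s i| `|edge s i.+1|)).
  by rewrite !lt_min e10 a0 a1.
move=> x; rewrite !lt_min => /and3P[xe1 xe2 xe3]; split.
  move=> /(He1 _ xe1)[j /orP[]/eqP jE]; rewrite (eq_side jE).
    move=> /sideP[t t01 ->]; rewrite onl onl0 !mulr0 mul0r lexx; split=> //.
    by rewrite mulrCA; apply: mulr_ge0; [lra|exact: ltW].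
  move=> /sideP[t t01 ->]; rewrite onr onr0 !mulr0 lexx; split=> //.
  by rewrite mulrCA; apply: mulr_ge0; [lra|exact: ltW].
move=> [h1 h2 /eqP]; rewrite mulf_eq0 => /orP[]/eqP/edge_side_eq0[t xE].
  apply: (side_boundary n0 (i := i)); rewrite xE; apply: in_side.
  move: h2; rewrite xE onl mulrCA pmulr_lge0// => h2.
  move: xe2; rewrite xE.
  have -> : vertex s i.+1 - (vertex s i + t *: edge s i) = (1 - t) *: edge s i.
    by rewrite /edge; apply/rowP => k; rewrite !mxE; ring.
  by rewrite normrZ gtr_pMl// ltr_norml; lra.
apply: (side_boundary n0 (i := i.+1)); rewrite xE; apply: in_side.
move: h1; rewrite xE onr mulrCA pmulr_lge0// => h1.
move: xe3; rewrite xE opprD addrA subrr sub0r normrN.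
by rewrite normrZ gtr_pMl// ltr_norml; lra.
Qed.

(* W is a union of components of the complement of the boundary. *)
Definition saturated W := W `<=` ~` boundary s /\
  forall x y, segment x y `<=` ~` boundary s -> W x -> W y.

(** Moving from [w] towards [z] never leaves [W], as the path meets no boundary point before [z]. *)
Lemma saturated_accessible W z w : saturated W -> W w ->
  (forall t, 0 < t <= 1 -> ~ boundary s ((1 - t) *: z + t *: w)) ->
  closure W z.
Proof.
move=> [_ satW] Ww acc; apply/closure_normP => e e0.
have [N0 N1] : 0 < `|w - z| + 1 /\ `|w - z| < `|w - z| + 1.
  by split; [rewrite ltr_wpDl|rewrite ltrDl].
pose t := Num.min 1 (e / (`|w - z| + 1)).
have t0 : 0 < t by rewrite lt_min ltr01 divr_gt0.
have t1 : t <= 1 by rewrite ge_min lexx.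
exists ((1 - t) *: z + t *: w).
  apply: (satW w) => // _ [r /= + <-]; rewrite in_itv/= => r01.
  have -> : (1 - r) *: w + r *: ((1 - t) *: z + t *: w) =
      (1 - (1 - r * (1 - t))) *: z + (1 - r * (1 - t)) *: w.
    by apply/rowP => k; rewrite !mxE; ring.
  by apply: (acc (1 - r * (1 - t))); nra.
have -> : z - ((1 - t) *: z + t *: w) = - (t *: (w - z)).
  by apply/rowP => k; rewrite !mxE; ring.
rewrite normrN normrZ gtr0_norm//.
apply: (@lt_le_trans _ _ (t * (`|w - z| + 1))); first by rewrite ltr_pM2l.
by rewrite -ler_pdivlMr// ge_min lexx orbT.
Qed.

(** Inside the disc the boundary is a line, so each open half disc is a convex set avoiding it. *)
Lemma saturated_half_disc W i z e w y : saturated W ->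
  (forall x, `|z - x| < e -> (boundary s x <-> edge_side s i x = 0)) ->
  `|z - w| < e -> `|z - y| < e -> 0 < edge_side s i w * edge_side s i y ->
  W w -> W y.
Proof.
move=> [_ satW] near zw zy wy; apply: satW => _ [t /= + <-].
rewrite in_itv/= => t01 /(near _ (norm_seg_lt t01 zw zy)).
by rewrite edge_side_segment => /eqP; rewrite (negbTE (conv_neq0 t01 wy)).
Qed.

Section Vertex.
Context (i : nat) (e : R) (e0 : 0 < e).
Context (near : vertex_chart i e).

(** The factor [turn s i] makes the formula independent of the orientation of the polygon. *)
Definition small_sector x :=
  0 < turn s i * edge_side s i x /\ 0 < turn s i * edge_side s i.+1 x.

(** This sector is not convex, but it is the union of two half planes. *)
Definition large_sector x :=
  turn s i * edge_side s i x < 0 \/ turn s i * edge_side s i.+1 x < 0.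

Lemma sector_cases x : `|vertex s i.+1 - x| < e -> ~ boundary s x ->
  small_sector x \/ large_sector x.
Proof.
move=> /near -> nB; rewrite /small_sector /large_sector.
have [h1|h1] := ltP (turn s i * edge_side s i x) 0; first by right; left.
have [h2|h2] := ltP (turn s i * edge_side s i.+1 x) 0; first by right; right.
left; rewrite !lt0r h1 h2 !andbT; apply/andP; rewrite -negb_or.
apply/negP => h; apply: nB; split=> //; apply/eqP.
by move: h; rewrite !mulf_eq0 (negbTE (turnS i)).
Qed.

Lemma saturated_small_sector W w y : saturated W ->
  `|vertex s i.+1 - w| < e -> `|vertex s i.+1 - y| < e ->
  small_sector w -> small_sector y -> W w -> W y.
Proof.
move=> [_ satW] zw zy [w1 w2] [y1 y2]; apply: satW => _ [t /= + <-].
rewrite in_itv/= => t01 /(near (norm_seg_lt t01 zw zy)).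
rewrite !edge_side_segment.
set a := edge_side s i w in w1 *; set b := edge_side s i.+1 w in w2 *.
set a' := edge_side s i y in y1 *; set b' := edge_side s i.+1 y in y2 *.
have := conv_gt0 t01 w1 y1; rewrite 2!(mulrCA _ (turn s i)) -mulrDr => p1.
have := conv_gt0 t01 w2 y2; rewrite 2!(mulrCA _ (turn s i)) -mulrDr => p2.
move=> [_ _ /eqP]; rewrite mulf_eq0 => /orP[]/eqP E.
  by rewrite E mulr0 ltxx in p1.
by rewrite E mulr0 ltxx in p2.
Qed.

Lemma saturated_large_half W w y : saturated W ->
  `|vertex s i.+1 - w| < e -> `|vertex s i.+1 - y| < e ->
  (turn s i * edge_side s i w < 0 /\ turn s i * edge_side s i y < 0) \/
  (turn s i * edge_side s i.+1 w < 0 /\ turn s i * edge_side s i.+1 y < 0) ->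
  W w -> W y.
Proof.
move=> [_ satW] zw zy H; apply: satW => _ [t /= + <-].
rewrite in_itv/= => t01 /(near (norm_seg_lt t01 zw zy)).
rewrite !edge_side_segment.
move=> [h1 h2 _]; case: H => -[H1 H2]; have := conv_lt0 t01 H1 H2;
  by rewrite 2!(mulrCA _ (turn s i)) -mulrDr ltNge ?h1 ?h2.
Qed.

(* The point found connects the two half planes that make up the large sector. *)
Lemma large_sector_hub d : 0 < d -> exists x, [/\ `|vertex s i.+1 - x| < d,
  turn s i * edge_side s i x < 0 & turn s i * edge_side s i.+1 x < 0].
Proof.
move=> d0; set u := edge s i - edge s i.+1.
have N0 : 0 < `|u| + 1 by rewrite ltr_wpDl.
pose t := d / (`|u| + 1); have t0 : 0 < t by rewrite divr_gt0.
have t2 : 0 < turn s i * turn s i by rewrite -expr2 exprn_even_gt0//= turnS.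
exists (vertex s i.+1 + t *: u); split.
- rewrite opprD addrA subrr sub0r normrN normrZ gtr0_norm//.
  by rewrite /t mulrAC ltr_pdivrMr// ltr_pM2l// ltrDl.
- rewrite edge_sideD edge_side_vertexS add0r crossZr /u crossDr crossNr crossvv.
  by rewrite -/(turn s i); nra.
- rewrite edge_sideD edge_side_vertex add0r crossZr /u crossDr crossNr crossvv.
  by rewrite (crossC (edge s i.+1)) -/(turn s i); nra.
Qed.

(** The route passes through the hub, which lies in both half planes. *)
Lemma saturated_large_sector W w y : saturated W ->
  `|vertex s i.+1 - w| < e -> `|vertex s i.+1 - y| < e ->
  large_sector w -> large_sector y -> W w -> W y.
Proof.
move=> satW zw zy lw ly Ww; have [h [zh h1 h2]] := large_sector_hub e0.
have Wh : W h.
  by case: lw => ?; apply: (saturated_large_half satW zw zh _ Ww); [left|right].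
by case: ly => ?; apply: (saturated_large_half satW zh zy _ Wh); [left|right].
Qed.

End Vertex.

Lemma closure_saturated_near_side W i z : saturated W ->
  side s i.+1 z -> closure W z ->
  \forall x \near z, boundary s x -> closure W x.
Proof.
move=> satW sz cWz.
suff [e e0 H] : exists2 e, 0 < e & forall x, `|z - x| < e ->
    boundary s x -> closure W x.
  by apply/nbhs_ballP; exists e => //= x; rewrite -ball_normE; apply: H.
have vertexP k : closure W (vertex s k.+1) ->
    exists2 e, 0 < e & forall x, `|vertex s k.+1 - x| < e ->
    boundary s x -> closure W x.
  move=> cW; have [e e0 near] := boundary_near_vertex k.
  exists e => // x zx Bx; have [x1 x2 _] := (near _ zx).1 Bx.
  (* This point of [W] lies in one of the two sectors; from it, or from the hub for the large one,
     all nearby boundary points are accessible. *)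
  have [w Ww zw] := (closure_normP _ _).1 cW _ e0.
  have [[w1 w2]|lw] := sector_cases near zw (satW.1 _ Ww).
    apply: (saturated_accessible satW Ww) => t t01.
    have t01' : 0 <= t <= 1 by case/andP: t01 => /ltW -> ->.
    move=> /(near _ (norm_seg_lt t01' zx zw)); rewrite !edge_side_segment.
    set a := edge_side s k w in w1 *; set b := edge_side s k.+1 w in w2 *.
    set a' := edge_side s k x in x1 *; set b' := edge_side s k.+1 x in x2 *.
    have := conv_pgt0 t01 x1 w1; rewrite 2!(mulrCA _ (turn s k)) -mulrDr => p1.
    have := conv_pgt0 t01 x2 w2; rewrite 2!(mulrCA _ (turn s k)) -mulrDr => p2.
    move=> [_ _ /eqP]; rewrite mulf_eq0 => /orP[]/eqP E.
      by rewrite E mulr0 ltxx in p1.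
    by rewrite E mulr0 ltxx in p2.
  have [h [zh h1 h2]] := large_sector_hub k e0.
  have Wh : W h.
    by apply: (saturated_large_sector e0 near satW zw zh lw _ Ww); left.
  apply: (saturated_accessible satW Wh) => t t01.
  have t01' : 0 <= t <= 1 by case/andP: t01 => /ltW -> ->.
  move=> /(near _ (norm_seg_lt t01' zx zh))[k1 k2 _].
  have [_ _ /eqP] := (near _ zx).1 Bx; rewrite mulf_eq0.
  by move=> /orP[]/eqP E; move: k1 k2; rewrite !edge_side_segment E; nra.
have [zv|zv] := eqVneq z (vertex s i.+1).
  by rewrite zv; apply: vertexP; rewrite -zv.
have [zv'|zv'] := eqVneq z (vertex s i.+2).
  by rewrite zv'; apply: vertexP; rewrite -zv'.
have [e e0 near] := boundary_near_side sz zv zv'.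
exists e => // x zx /(near _ zx) x0.
have [w Ww zw] := (closure_normP _ _).1 cWz _ e0.
have w0 : edge_side s i.+1 w != 0.
  by apply/eqP => /(near _ zw); apply: satW.1.
apply: (saturated_accessible satW Ww) => t t01.
have t01' : 0 <= t <= 1 by case/andP: t01 => /ltW -> ->.
move=> /(near _ (norm_seg_lt t01' zx zw)).
rewrite edge_side_segment x0 mulr0 add0r => /eqP; rewrite mulf_eq0 (negbTE w0) orbF.
by case/andP: t01 => /gt_eqF ->.
Qed.

(** Within the connected side, the limit points of [W] form a nonempty closed set, which is also
    open by [closure_saturated_near_side]. *)
Lemma side_sub_closure W i z : saturated W -> side s i.+1 z -> closure W z ->
  side s i.+1 `<=` closure W.
Proof.
move=> satW sz cWz.
suff -> : side s i.+1 = side s i.+1 `&` closure W by move=> x [].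
apply/esym/(@connected_seg _ (vertex s i.+1) (vertex s i.+2)).
- by exists z.
- exists (interior (closure W `|` ~` side s i.+1)); first exact: open_interior.
  apply/seteqP; split=> x [sx]; last first.
    by move=> /interior_subset[cW|]; split.
  move=> cWx; split=> //; have := closure_saturated_near_side satW sx cWx.
  apply: filterS => y By; have [sy|] := pselect (side s i.+1 y); last by right.
  by left; apply: By; apply: side_boundary sy.
- by exists (closure W) => //; exact: closed_closure.
Qed.

(** Consecutive sides share a vertex, so the property passes from each side to the next, all round
    the polygon. *)
Lemma boundary_sub_closure W z : saturated W -> boundary s z -> closure W z ->
  boundary s `<=` closure W.
Proof.
move=> satW [i _ sz] cWz.
(* Adding [n] turns the index into a successor without changing the side. *)
have base : side s (i + n) `<=` closure W.
  case E : (i + n)%N => [|k]; first by move: E n0; lia.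
  apply: (side_sub_closure satW _ cWz); rewrite -E.
  by rewrite -side_mod modnDr side_mod.
have step k : side s (i + n + k) `<=` closure W.
  elim: k => [|k IH]; first by rewrite addn0.
  rewrite addnS; apply: (side_sub_closure satW (side_left _ _)).
  exact/IH/side_right.
(* This many steps lead from [i + n] to a number congruent to [j]. *)
move=> x [j _]; have := step (i * n.-1 + j + n)%N.
rewrite (_ : (i + n + (i * n.-1 + j + n) = (i + 2) * n + j)%N).
  by rewrite -side_mod modnMDl side_mod => + sx; exact.
by case: n n0 => // m _ /=; ring.
Qed.

End LocalStructure.

(** * Unoriented angles and their cosines *)

Section Angles.
Context {R : realType}.
Implicit Types (p q r u w : 'rV[R]_2).

(** The Cauchy-Schwarz inequality, read off Lagrange's identity. *)
Lemma edot_le_norm u w : `|edot u w| <= enorm u * enorm w.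
Proof.
rewrite -ler_sqr ?nnegrE ?mulr_ge0 ?sqrtr_ge0// exprMn !sqr_enorm real_normK ?num_real//.
by rewrite -Lagrange_identity lerDr sqr_ge0.
Qed.

Lemma cosine_bound u w : u != 0 -> w != 0 ->
  -1 <= edot u w / (enorm u * enorm w) <= 1.
Proof.
move=> u0 w0; have N0 : 0 < enorm u * enorm w by rewrite mulr_gt0 ?enorm_gt0.
by rewrite -ler_norml normrM normfV (gtr0_norm N0) ler_pdivrMr// mul1r edot_le_norm.
Qed.

(** The equality case of Cauchy-Schwarz. *)
Lemma cosine_cross u w : u != 0 -> w != 0 ->
  (edot u w / (enorm u * enorm w)) ^+ 2 = 1 <-> cross u w = 0.
Proof.
move=> u0 w0; have uw0 : edot u u * edot w w != 0.
  by rewrite mulf_neq0 ?edot_eq0.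
rewrite expr_div_n exprMn !sqr_enorm.
have L := Lagrange_identity u w; split=> [h|c0].
  have E : edot u w ^+ 2 = edot u u * edot w w by rewrite -[LHS](divfK uw0) h mul1r.
  by apply/eqP; rewrite -sqrf_eq0; apply/eqP; lra.
by move: uw0; rewrite -L c0 expr0n add0r => /divff.
Qed.

Lemma angle_lt_pi p q r : p != q -> r != q -> cross (p - q) (r - q) != 0 ->
  0 < angle p q r < pi.
Proof.
rewrite -subr_eq0 -(subr_eq0 r) /angle => pq rq /eqP c0.
have /andP[h1 h2] := cosine_bound pq rq.
have := (cosine_cross pq rq).1; set c := edot _ _ / _ in h1 h2 * => cE.
have c1 : c != 1 by apply/eqP => E; apply/c0/cE; rewrite E expr1n.
have c2 : c != -1 by apply/eqP => E; apply/c0/cE; rewrite E sqrrN expr1n.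
by rewrite acos_gt0 ?acos_ltpi// ?h1 ?h2 lt_neqAle ?h1 ?h2 ?andbT// eq_sym.
Qed.

Lemma angle_degenerate p q r : p != q -> r != q -> cross (p - q) (r - q) = 0 ->
  angle p q r = 0 \/ angle p q r = pi.
Proof.
rewrite -subr_eq0 -(subr_eq0 r) /angle => pq rq /(cosine_cross pq rq)/eqP.
by rewrite sqrf_eq1 => /orP[]/eqP ->; [left; rewrite acos1|right; rewrite acosN1].
Qed.

Lemma angle_le_pi p q r : p != q -> r != q -> angle p q r <= pi.
Proof.
by rewrite -subr_eq0 -(subr_eq0 r) => pq rq; rewrite acos_lepi// cosine_bound.
Qed.

End Angles.

(** * Components of the complement of the boundary *)

Section Components.
Context {R : realType} (s : seq 'rV[R]_2).
Implicit Types (x y z : 'rV[R]_2) (i j : nat).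

Lemma segment_component x y : segment x y `<=` ~` boundary s ->
  connected_component (~` boundary s) x = connected_component (~` boundary s) y.
Proof.
move=> xy; apply: same_connected_component.
apply: (connected_component_max (segment_left x y) xy); first exact: connected_seg.
exact: segment_right.
Qed.

Lemma component_saturated x :
  saturated s (connected_component (~` boundary s) x).
Proof.
split=> [|y z yz xy]; first exact: connected_component_sub.
rewrite (same_connected_component xy) (segment_component yz).
exact/connected_component_refl/yz/segment_right.
Qed.

Lemma inside_saturated : saturated s (inside s).
Proof.
split=> [x []//|x y xy [_ bx]].
by split; [exact/xy/segment_right|rewrite -(segment_component xy)].
Qed.

Lemma outside_saturated : saturated s (~` (boundary s `|` inside s)).
Proof.
split=> [x nx Bx|x y xy nx]; first by apply: nx; left.
move=> [|yin]; first exact/xy/segment_right.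
apply: nx; right; apply: inside_saturated.2 yin.
by rewrite segment_sym.
Qed.

Lemma open_not_boundary : open (~` boundary s).
Proof.
apply/closed_openC/closed_bigcup => [|j _]; first exact: finite_II.
exact: closed_seg.
Qed.

(** At a vertex with the largest first coordinate, the ray pointing in that direction misses the
    polygon, so its component is unbounded. *)
Lemma vertex_closure_outside : polygon s ->
  exists2 i, (i < size s)%N & closure (~` (boundary s `|` inside s)) (vertex s i).
Proof.
move=> polS; have n0 := size_polygon_gt0 polS.
pose F (i : 'I_(size s)) := vertex s i 0 0.
case: (@arg_maxP _ _ _ (Ordinal n0) xpredT F isT) => i _ iM.
pose d : 'rV[R]_2 := delta_mx 0 0.
have vM k : vertex s k 0 0 <= vertex s i 0 0.
  rewrite -vertex_mod; have kn : (k %% size s < size s)%N by rewrite ltn_mod.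
  exact: (iM (Ordinal kn)).
have ray t : 0 < t -> ~ boundary s (vertex s i + t *: d).
  move=> t0 [j _ [r /=]]; rewrite in_itv/= => /andP[r0 r1] /rowP/(_ 0).
  rewrite !mxE eqxx mulr1; have := vM j; have := vM j.+1; set a := vertex s i 0 0.
  by nra.
exists i => //; apply/closure_normP => e e0.
exists (vertex s i + (e / 2) *: d); last first.
  rewrite opprD addrA subrr sub0r normrN normrZ gtr0_norm ?divr_gt0//.
  have d1 : `|d| <= 1.
    rewrite /d [`|_|]/Num.norm/= mx_normrE; apply: bigmax_le => // -[a b] _ /=.
    by rewrite mxE; case: (_ && _); rewrite ?normr1 ?normr0.
  by nra.
move=> [|[_]]; first exact/ray/divr_gt0.
move=> [M [_ /(_ (M + 1))]]; rewrite ltrDl => /(_ ltr01) bM.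
set x0 := _ + _ in bM.
(* Far enough along the ray for the first coordinate to exceed the supposed bound [M + 1]. *)
pose t := `|vertex s i 0 0| + `|M + 1| + 1.
have t0 : 0 < t by rewrite ltr_wpDl ?addr_ge0.
have {bM} := bM (vertex s i + t *: d); rewrite /globally/= => bM.
suff /bM : connected_component (~` boundary s) x0 (vertex s i + t *: d).
  move=> h; have := le_trans (coord_le_norm _ 0) h; rewrite !mxE eqxx mulr1.
  rewrite ler_norml /t => /andP[_].
  have := ler_norm (M + 1); have := lerNnormlW (lexx `|vertex s i 0 0|).
  by lra.
have seg : segment x0 (vertex s i + t *: d) `<=` ~` boundary s.
  move=> _ [r /= + <-]; rewrite in_itv/= => r01.
  have -> : (1 - r) *: x0 + r *: (vertex s i + t *: d) =
      vertex s i + ((1 - r) * (e / 2) + r * t) *: d.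
    by rewrite /x0; apply/rowP => k; rewrite !mxE; ring.
  by apply: ray; apply: conv_gt0 => //; rewrite divr_gt0.
rewrite (segment_component seg); apply: connected_component_refl.
exact/seg/segment_right.
Qed.

End Components.

(** * Local consequences of interior angles below pi *)

Section LocalConvexity.
Context {R : realType} (s : seq 'rV[R]_2).
Context (convS : convex_polygon s).
Context (angS : forall i, (i < size s)%N ->
  vertex_angle s i != 0 /\ vertex_angle s i != pi).
Implicit Types (x y z : 'rV[R]_2) (i j : nat) (e : R).

Let polS : polygon s. Proof. by case: convS. Qed.
Let simS : simple_polygon s. Proof. by case: convS. Qed.
Let n0 : (0 < size s)%N := size_polygon_gt0 polS.

Lemma turn_neq0 i : turn s i != 0.
Proof.
have [_ vS] := polS; have := angS (i := (i.+1 %% size s)%N).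
rewrite ltn_mod => /(_ n0); rewrite vertex_angleS// => -[a0 api]; apply/eqP => t0.
have c0 : cross (vertex s i - vertex s i.+1) (vertex s i.+2 - vertex s i.+1) = 0.
  by rewrite -opprB crossNl -/(edge s i) -/(edge s i.+1) -/(turn s i) t0 oppr0.
have v1 : vertex s i.+2 != vertex s i.+1 by rewrite eq_sym.
by have [E|E] := angle_degenerate (vS i) v1 c0; [move: a0|move: api]; rewrite E eqxx.
Qed.

Let turnS := turn_neq0.

(** Otherwise the interior angle would be [2 * pi] minus an angle of at most [pi], hence not below
    [pi]. *)
Lemma bisector_inside i : \forall e \near 0^'+,
  inside s (vertex s i.+1 + e *: (unit_vec (- edge s i) + unit_vec (edge s i.+1))).
Proof.
have [_ _ /(_ (i.+1 %% size s)%N)] := convS; rewrite ltn_mod => /(_ n0).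
rewrite /interior_angle vertex_angleS// prev_vertex_mod prev_vertexS//.
rewrite vertex_mod vertexS_mod.
rewrite -(opprB (vertex s i.+1)) -/(edge s i) -/(edge s i.+1).
have [_ vS] := polS; have v1 : vertex s i.+2 != vertex s i.+1 by rewrite eq_sym.
have := angle_le_pi (vS i) v1.
by case: asboolP => // _ h1 h2; lra.
Qed.

(** The bisector enters the small sector and is inside near the vertex; saturation spreads this over
    the sector. *)
Lemma small_sector_inside i e x : 0 < e -> vertex_chart s i e ->
  `|vertex s i.+1 - x| < e -> small_sector s i x -> inside s x.
Proof.
move=> e0 near vx sx; set b := unit_vec (- edge s i) + unit_vec (edge s i.+1).
have N0 : 0 < `|b| + 1 by rewrite ltr_wpDl.
have d0 : 0 < e / (`|b| + 1) by rewrite divr_gt0.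
have [t [[inb t0] td]] := filter_ex
  (filterI (filterI (bisector_inside i) (nbhs_right_gt 0)) (nbhs_right_lt d0)).
have t2 : 0 < turn s i * turn s i by rewrite -expr2 exprn_even_gt0//= turnS.
have Ei : 0 < (enorm (- edge s i))^-1.
  by rewrite invr_gt0 enorm_gt0// oppr_eq0 polygon_edge_neq0.
have Ei1 : 0 < (enorm (edge s i.+1))^-1.
  by rewrite invr_gt0 enorm_gt0// polygon_edge_neq0.
apply: (saturated_small_sector near (@inside_saturated _ s) _ vx _ sx inb).
  rewrite opprD addrA subrr sub0r normrN normrZ gtr0_norm//.
  have : t * (`|b| + 1) < e by rewrite -ltr_pdivlMr.
  by have := normr_ge0 b; rewrite /b; nra.
split.
  rewrite edge_sideD edge_side_vertexS add0r crossZr crossDr !crossZr crossNr crossvv.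
  rewrite oppr0 mulr0 add0r -/(turn s i) mulrCA; apply: mulr_gt0 => //.
  by rewrite mulrCA mulr_gt0.
rewrite edge_sideD edge_side_vertex add0r crossZr crossDr !crossZr crossNr crossvv.
rewrite (crossC (edge s i.+1)) opprK mulr0 addr0 -/(turn s i) mulrCA.
by apply: mulr_gt0 => //; rewrite mulrCA mulr_gt0.
Qed.

Lemma boundary_sub_closure_outside :
  boundary s `<=` closure (~` (boundary s `|` inside s)).
Proof.
have [i _ ci] := vertex_closure_outside polS.
apply: (boundary_sub_closure polS simS turnS _ _ ci); first exact: outside_saturated.
exact: (side_boundary n0 (side_left s i)).
Qed.

(** The outside accumulates at the vertex, and not through the small sector; so it meets the large
    one and fills it. *)
Lemma large_sector_outside i e x : 0 < e -> vertex_chart s i e ->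
  `|vertex s i.+1 - x| < e -> large_sector s i x -> ~ inside s x.
Proof.
move=> e0 near vx lx.
have Bv := side_boundary n0 (side_left s i.+1).
have [w Ow vw] := (closure_normP _ _).1 (boundary_sub_closure_outside Bv) _ e0.
have lw : large_sector s i w.
  have [sw|//] := sector_cases turnS near vw ((@outside_saturated _ s).1 _ Ow).
  by case: Ow; right; exact: (small_sector_inside e0 near vw sw).
have := saturated_large_sector turnS e0 near (@outside_saturated _ s) vw vx lw lx Ow.
by move=> nx ix; apply: nx; right.
Qed.

(** At a vertex, [d] is the turn there; elsewhere on the side, its sign is opposite to that of
    [edge_side] at some nearby outside point. *)
Lemma inside_one_sided i z : side s i z -> exists d e, [/\ 0 < e, d != 0 &
  forall x, `|z - x| < e -> d * edge_side s i x < 0 -> ~ inside s x].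
Proof.
wlog [k ->] : i / exists k, i = k.+1 => [H|] sz.
  have pk : exists k, (i + size s)%N = k.+1.
    by exists (i + (size s).-1)%N; rewrite -addnS prednK.
  have szn : side s (i + size s) z by rewrite -side_mod modnDr side_mod.
  have [d [e [e0 d0 P]]] := H _ pk szn.
  exists d, e; split=> // x zx; have := P x zx.
  by rewrite /edge_side /edge -addSn !vertex_size.
have [zv|zv] := eqVneq z (vertex s k.+1).
  have [e e0 near] := boundary_near_vertex polS simS turnS k.
  exists (turn s k), e; split=> // x; rewrite zv => vx h.
  by apply: (large_sector_outside e0 near vx); right.
have [zv'|zv'] := eqVneq z (vertex s k.+2).
  have [e e0 near] := boundary_near_vertex polS simS turnS k.+1.
  exists (turn s k.+1), e; split=> // x; rewrite zv' => vx h.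
  by apply: (large_sector_outside e0 near vx); left.
have [e e0 near] := boundary_near_side polS simS sz zv zv'.
have Bz := side_boundary n0 sz.
have [w Ow zw] := (closure_normP _ _).1 (boundary_sub_closure_outside Bz) _ e0.
exists (- edge_side s k.+1 w), e; split=> //.
  rewrite oppr_eq0; apply/eqP => /(near _ zw) Bw.
  by apply: Ow; left.
move=> x zx; rewrite mulNr oppr_lt0 => h ix.
have := saturated_half_disc (@outside_saturated _ s) near zw zx h Ow.
by apply; right.
Qed.

Section Component.
Context (x0 : 'rV[R]_2) (x0in : inside s x0).

Let U := connected_component (~` boundary s) x0.

Lemma component_inside : U `<=` inside s.
Proof.
move=> x Ux; split; first exact: connected_component_sub Ux.
by rewrite -(same_connected_component Ux); case: x0in.
Qed.

(* Tietze's argument.  At the first boundary point of a limit of segments inside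
   the component, local one-sidedness forces the segment to run along the line
   of a side, so that the boundary was reached earlier. *)
Lemma limit_of_visible x y : U x -> U y ->
  closure [set z | U z /\ segment x z `<=` ~` boundary s] y ->
  segment x y `<=` ~` boundary s.
Proof.
move=> Ux Uy cy.
pose g t := (1 - t) *: x + t *: y.
have gU t : 0 <= t <= 1 -> closure U (g t).
  move=> t01; apply/closure_normP => e e0.
  have [w [Uw xw] yw] := (closure_normP _ _).1 cy _ e0.
  exists ((1 - t) *: x + t *: w).
    apply: (component_saturated s x0).2 Ux => _ [r /= + <-].
    rewrite in_itv/= => r01; apply: xw; exists (r * t).
      by rewrite /= in_itv/=; nra.
    by apply/rowP => k; rewrite !mxE; ring.
  have -> : g t - ((1 - t) *: x + t *: w) = t *: (y - w).
    by apply/rowP => k; rewrite /g !mxE; ring.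
  case/andP: t01 => t0 t1; rewrite normrZ ger0_norm//.
  by have := normr_ge0 (y - w); nra.
apply: contrapT => /existsNP[_ /not_implyP[[t0 /= t0itv <-] Bt0]].
(* Compactness of [T] gives the first parameter at which the boundary is met. *)
pose T := `[0, 1] `&` (g @^-1` boundary s).
have clB : closed (boundary s).
  by rewrite -[boundary s]setCK; apply: open_closedC; exact: open_not_boundary.
have cT : compact T.
  apply: compact_closedI; first exact: segment_compact.
  by apply: preimage_closed clB => r _; exact: continuous_segment.
have T0 : T !=set0 by exists t0; split=> //; exact: contrapT.
have idc : {within T, continuous (id : R -> R)}.
  by apply: continuous_subspaceT => r; exact: cvg_id.
have [t /set_mem[]] := compact_EVT_min T0 cT idc.
rewrite /= in_itv/= => /andP[tge0 tle1] Bgt tmin.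
have tn0 : t != 0.
  apply: contraTneq isT => th; have := connected_component_sub Ux.
  by move: Bgt; rewrite /g th subr0 scale1r scale0r addr0.
have tn1 : t != 1.
  apply: contraTneq isT => th; have := connected_component_sub Uy.
  by move: Bgt; rewrite /g th subrr scale1r scale0r add0r.
have t0' : 0 < t by rewrite lt0r tn0.
have t1' : t < 1 by rewrite lt_neqAle tn1.
have gdiff r : g t - g r = (t - r) *: (y - x).
  by apply/rowP => k; rewrite /g !mxE; ring.
have Nyx : 0 < `|y - x| + 1 by rewrite ltr_wpDl.
(* The margins keep [t - d] and [t + d] in the unit interval. *)
have near_g e : 0 < e -> exists d, [/\ 0 < d, d < t, d < 1 - t &
    forall r, `|t - r| <= d -> `|g t - g r| < e].
  move=> e0; pose d := Num.min (Num.min (t / 2) ((1 - t) / 2)) (e / (`|y - x| + 1)).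
  have d0 : 0 < d by rewrite !lt_min !divr_gt0// subr_gt0.
  have [d1 d2] : d <= t / 2 /\ d <= (1 - t) / 2.
    by split; rewrite !ge_min lexx ?orbT.
  have d3 : d * (`|y - x| + 1) <= e by rewrite -ler_pdivlMr// ge_min lexx orbT.
  exists d; split=> //; [lra|lra|] => r tr; rewrite gdiff normrZ.
  by have := normr_ge0 (y - x); have := normr_ge0 (t - r); nra.
have on_line i : side s i (g t) -> edge_side s i x = 0 /\ edge_side s i y = 0.
  move=> sgt; have [d [e [e0 dn0 out]]] := inside_one_sided sgt.
  have [k [k0 kt kt1 kg]] := near_g _ e0.
  have ge r : `|t - r| <= k -> 0 <= d * edge_side s i (g r).
    move=> tr; have r01 : 0 <= r <= 1 by move: tr; rewrite ler_norml; lra.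
    rewrite leNgt; apply/negP => neg.
    pose M := 2 * `|edge s i| * `|d|.
    have M0 : 0 < M + 1 by rewrite ltr_wpDl// !mulr_ge0.
    have e'0 : 0 < Num.min (e - `|g t - g r|) (- (d * edge_side s i (g r)) / (M + 1)).
      by rewrite lt_min subr_gt0 kg// divr_gt0// oppr_gt0.
    have [u Uu] := (closure_normP _ _).1 (gU _ r01) _ e'0.
    rewrite lt_min ltr_pdivlMr// => /andP[u1 u2].
    apply: (out u _ _ (component_inside Uu)).
      rewrite -(subrK (g r) (g t)) -addrA; apply: le_lt_trans (ler_normD _ _) _; lra.
    have := edge_side_lipschitz s i (g r) u => L.
    have : `|d * (edge_side s i (g r) - edge_side s i u)| <= M * `|g r - u|.
      by rewrite normrM /M mulrAC mulrC ler_wpM2r.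
    rewrite ler_norml => /andP[+ _].
    by have := normr_ge0 (g r - u); nra.
  have gt0 : edge_side s i (g t) = 0 by exact: edge_side_on.
  (* An affine function of the parameter that vanishes at [t] and has the same weak sign before and
     after is constant. *)
  have k1 := ge (t - k) _; have k2 := ge (t + k) _.
  have {}k1 := k1 (_ : `|t - (t - k)| <= k).
  have {}k2 := k2 (_ : `|t - (t + k)| <= k).
  move: k1 k2.
  rewrite opprB addrC subrK gtr0_norm// lexx => /(_ isT) k1.
  rewrite opprD addrA subrr sub0r normrN gtr0_norm// lexx => /(_ isT) k2.
  move: gt0 k1 k2; rewrite !edge_side_segment.
  set a := edge_side s i x; set b := edge_side s i y => gt0 k1 k2.
  have ab : a = b.
    have e1 : d * (k * (a - b)) = d * ((1 - (t - k)) * a + (t - k) * b)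
      - d * ((1 - t) * a + t * b) by ring.
    have e2 : d * (k * (a - b)) = d * ((1 - t) * a + t * b)
      - d * ((1 - (t + k)) * a + (t + k) * b) by ring.
    have h1 : 0 <= d * (k * (a - b)) by rewrite e1 gt0 mulr0 subr0.
    have h2 : d * (k * (a - b)) <= 0 by rewrite e2 gt0 mulr0 sub0r oppr_le0.
    have /eqP : d * (k * (a - b)) = 0 by apply/eqP; rewrite eq_le h1 h2.
    by rewrite !mulf_eq0 (negbTE dn0) gt_eqF//= subr_eq0 => /eqP.
  by move: gt0; rewrite -ab -mulrDl subrK mul1r.
(* At a vertex, [x] would lie on two lines that cross only there, and so be a boundary point. *)
have not_vertex j : g t != vertex s j.+1.
  apply/eqP => gv.
  have [xj _] : edge_side s j x = 0 /\ edge_side s j y = 0.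
    by apply: on_line; rewrite gv; exact: side_right.
  have [xj1 _] : edge_side s j.+1 x = 0 /\ edge_side s j.+1 y = 0.
    by apply: on_line; rewrite gv; exact: side_left.
  have [r xE] := edge_side_eq0 polS xj.
  move: xj1; rewrite xE edge_sideD edge_sideS_vertex crossZr (crossC (edge s j.+1)).
  rewrite -/(turn s j) mulrN -{1}(mul1r (turn s j)) -mulrBl => /eqP.
  rewrite mulf_eq0 (negbTE (turnS j)) orbF subr_eq0 => /eqP r1.
  apply: (connected_component_sub Ux); rewrite xE -r1 scale1r /edge subrKC.
  exact: (side_boundary n0 (side_right s j)).
have [i _ sgt] : boundary s (g t) by [].
have [k E] : exists k, side s i = side s k.+1.
  exists (i + (size s).-1)%N; rewrite -addnS prednK//.
  by rewrite -[RHS]side_mod modnDr side_mod.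
rewrite E in sgt.
have [e e0 near] := boundary_near_side polS simS sgt (not_vertex _) (not_vertex _).
have [d [d0 dt _ dg]] := near_g _ e0.
have [xk yk] := on_line _ sgt.
have tdd : `|t - (t - d)| <= d by rewrite opprB addrC subrK gtr0_norm.
(* Near [g t] the boundary is the line that carries the segment, so it is met before [t]. *)
have Btd : boundary s (g (t - d)).
  by apply/(near _ (dg _ tdd)); rewrite edge_side_segment xk yk !mulr0 addr0.
have : t <= t - d.
  by apply: tmin; apply/mem_set; split=> //=; rewrite in_itv/=; lra.
by lra.
Qed.

End Component.

End LocalConvexity.

(** * From local to global convexity *)

Section GlobalConvexity.
Context {R : realType} (s : seq 'rV[R]_2).
Context (convS : convex_polygon s).
Context (angS : forall i, (i < size s)%N ->
  vertex_angle s i != 0 /\ vertex_angle s i != pi).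
Implicit Types (x y z : 'rV[R]_2) (i j : nat) (e : R).

Let polS : polygon s. Proof. by case: convS. Qed.
Let simS : simple_polygon s. Proof. by case: convS. Qed.
Let n0 : (0 < size s)%N := size_polygon_gt0 polS.
Let turnS := turn_neq0 convS angS.

(** Compactness makes the radius uniform along the segment. *)
Lemma segment_nbhd x z : segment x z `<=` ~` boundary s ->
  exists2 e, 0 < e & forall p y, segment x z p -> `|p - y| < e -> ~ boundary s y.
Proof.
move=> xz; have cseg : compact (segment x z).
  apply: continuous_compact; last exact: segment_compact.
  exact/continuous_subspaceT/continuous_segment.
have [|e [e0 H]] := filter_ex (filterI (nbhs_right_gt (0 : R))
  ((compact_near_coveringP _).1 cseg _ (0^'+)
    (fun e p => forall y, `|p - y| < e -> ~ boundary s y) _ _)); last first.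
  by exists e => // p y /H; apply.
move=> p /xz Bp; have := open_nbhs_nbhs (conj (@open_not_boundary _ s) Bp).
move=> /nbhs_ballP[r /= r0 rB].
near=> p' e => y /= p'y; apply: rB; rewrite -ball_normE/=.
rewrite -(subrK p' p) -addrA; apply: le_lt_trans (ler_normD _ _) _.
have : `|p - p'| < r / 2.
  near: p'; apply/nbhs_ballP; exists (r / 2); first by rewrite /= divr_gt0.
  by move=> q; rewrite -ball_normE.
have : e < r / 2 by near: e; apply: nbhs_right_lt; rewrite divr_gt0.
by lra.
Unshelve. all: by end_near. Qed.

(** The points of the component visible from [x] form a nonempty subset, open by [segment_nbhd] and
    closed in it by [limit_of_visible]; connectedness leaves only the whole component. *)
Lemma component_visible x0 x y : inside s x0 ->
  connected_component (~` boundary s) x0 x ->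
  connected_component (~` boundary s) x0 y -> segment x y `<=` ~` boundary s.
Proof.
move=> in0; set U := connected_component _ _ => Ux Uy.
pose A := [set z | U z /\ segment x z `<=` ~` boundary s].
suff AU : A = U by have [] : A y by rewrite AU.
apply: (@component_connected _ (~` boundary s) x0).
- exists x; split=> // _ [t _ <-].
  by rewrite -scalerDl subrK scale1r; exact: connected_component_sub Ux.
- exists (interior [set z | segment x z `<=` ~` boundary s]).
    exact: open_interior.
  apply/seteqP; split=> z [Uz]; last by move=> /interior_subset; split.
  move=> xz; split=> //; have [e e0 He] := segment_nbhd xz.
  apply/nbhs_ballP; exists e => //= w; rewrite -ball_normE/= => zw _ [t t01 <-].
  apply: (He ((1 - t) *: x + t *: z)); first by exists t.
  have -> : (1 - t) *: x + t *: z - ((1 - t) *: x + t *: w) = t *: (z - w).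
    by apply/rowP => k; rewrite !mxE; ring.
  move: t01; rewrite /= in_itv/= => /andP[t0 t1]; rewrite normrZ ger0_norm//.
  by have := normr_ge0 (z - w); nra.
- exists (closure A); first exact: closed_closure.
  apply/seteqP; split=> z; first by move=> Az; split; [case: Az|exact: subset_closure].
  by move=> [Uz cAz]; split=> //; exact: (limit_of_visible convS angS in0 Ux Uz cAz).
Qed.

Lemma small_sector_point i e : 0 < e ->
  exists2 x, `|vertex s i.+1 - x| < e & small_sector s i x.
Proof.
move=> e0; set u := edge s i.+1 - edge s i.
have N0 : 0 < `|u| + 1 by rewrite ltr_wpDl.
pose t := e / (`|u| + 1); have t0 : 0 < t by rewrite divr_gt0.
have t2 : 0 < turn s i * turn s i by rewrite -expr2 exprn_even_gt0//= turnS.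
exists (vertex s i.+1 + t *: u).
  rewrite opprD addrA subrr sub0r normrN normrZ gtr0_norm//.
  by rewrite /t mulrAC ltr_pdivrMr// ltr_pM2l// ltrDl.
split.
  rewrite edge_sideD edge_side_vertexS add0r crossZr /u crossDr crossNr crossvv.
  by rewrite -/(turn s i); nra.
rewrite edge_sideD edge_side_vertex add0r crossZr /u crossDr crossNr crossvv.
by rewrite (crossC (edge s i.+1)) -/(turn s i); nra.
Qed.

(** A component meeting the small sector at one vertex accumulates there, hence along the whole
    boundary. *)
Lemma inside_component_closure : exists2 x0, inside s x0 &
  boundary s `<=` closure (connected_component (~` boundary s) x0).
Proof.
have [e e0 near] := boundary_near_vertex polS simS turnS 0.
have [x0 vx0 sx0] := small_sector_point 0 e0.
have x0in := small_sector_inside convS angS e0 near vx0 sx0.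
exists x0 => //; have satU := component_saturated s x0.
apply: (@boundary_sub_closure _ _ polS simS turnS _ (vertex s 1)) => //.
  exact: (side_boundary n0 (side_left s 1)).
apply: (saturated_accessible satU (w := x0)).
  by apply: connected_component_refl; case: x0in.
move=> t t01; have t01' : 0 <= t <= 1 by case/andP: t01 => /ltW -> ->.
have vv : `|vertex s 1 - vertex s 1| < e by rewrite subrr normr0.
move=> /(near _ (norm_seg_lt t01' vv vx0))[_ _ /eqP].
rewrite !edge_side_segment edge_side_vertexS edge_side_vertex !mulr0 !add0r.
case/andP: t01 => t0 _; case: sx0; rewrite !mulf_eq0 gt_eqF//=.
by move=> + + /orP[]/eqP h; rewrite h mulr0 ltxx.
Qed.

(** A point [x] of the component on the wrong side is visible from component points near the start
    of the side; a small move from there towards [x] would contradict [inside_one_sided]. *)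
Lemma polygon_one_sided i : exists2 d, d != 0 &
  forall x, boundary s x -> 0 <= d * edge_side s i x.
Proof.
have [x0 x0in bU] := inside_component_closure.
have satU := component_saturated s x0.
set U := connected_component _ _ in bU satU.
have si := side_left s i; set p := vertex s i in si *.
have [d [e [e0 d0 out]]] := inside_one_sided convS angS si; exists d => //.
pose M := 2 * `|edge s i| * `|d|.
have M0 : 0 < M + 1 by rewrite ltr_wpDl// !mulr_ge0.
have lip x y : d * edge_side s i x <= d * edge_side s i y + M * `|x - y|.
  have : `|d * (edge_side s i x - edge_side s i y)| <= M * `|x - y|.
    by rewrite normrM /M mulrAC mulrC ler_wpM2r// edge_side_lipschitz.
  by move=> /ler_normlW; rewrite mulrBr lerBlDl.
have UP x : U x -> 0 <= d * edge_side s i x.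
  move=> Ux; rewrite leNgt; apply/negP => neg.
  pose l := Num.min 1 (e / (2 * (`|p - x| + 1))).
  have N0 : 0 < 2 * (`|p - x| + 1) by rewrite mulr_gt0// ltr_wpDl.
  have l0 : 0 < l by rewrite lt_min ltr01 divr_gt0.
  have l1 : l <= 1 by rewrite ge_min lexx.
  have l2 : l * (2 * (`|p - x| + 1)) <= e by rewrite -ler_pdivlMr// ge_min lexx orbT.
  (* The point [u] will be so close to [p] that its own value cannot offset the share [l] of the
     negative value at [x]. *)
  have r0 : 0 < Num.min (e / 2) (l * - (d * edge_side s i x) / (M + 1)).
    by rewrite lt_min !divr_gt0// mulr_gt0// oppr_gt0.
  have [u Uu] := (closure_normP _ _).1 (bU _ (side_boundary n0 si)) _ r0.
  rewrite lt_min => /andP[u1]; rewrite ltr_pdivlMr// => u2.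
  have l01 : 0 <= l <= 1 by rewrite ltW.
  have ux := component_visible x0in Uu Ux.
  have Uy : U ((1 - l) *: u + l *: x).
    apply: satU.2 Uu => _ [r /= + <-]; rewrite in_itv/= => r01.
    apply: ux; exists (r * l); first by rewrite /= in_itv/=; nra.
    by apply/rowP => k; rewrite !mxE; ring.
  apply: (out _ _ _ (component_inside x0in Uy)).
    have -> : p - ((1 - l) *: u + l *: x) = (1 - l) *: (p - u) + l *: (p - x).
      by apply/rowP => k; rewrite !mxE; ring.
    apply: le_lt_trans (ler_normD _ _) _.
    rewrite !normrZ !ger0_norm ?subr_ge0 ?(ltW l0)//.
    by have := normr_ge0 (p - u); nra.
  have := lip u p; rewrite edge_side_vertex mulr0 add0r distrC => Lu.
  rewrite edge_side_segment mulrDr !(mulrCA d).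
  have := normr_ge0 (p - u).
  have Mn : 0 <= M by rewrite !mulr_ge0.
  set a := d * edge_side s i u in Lu *; set b := d * edge_side s i x in u2 neg *.
  set q := `|p - u| in Lu u1 u2 *.
  move=> q0; have Mq : 0 <= M * q by rewrite mulr_ge0.
  have h : (1 - l) * a <= M * q.
    apply: le_trans (_ : (1 - l) * (M * q) <= _); last by nra.
    by rewrite ler_wpM2l// subr_ge0.
  by move: u2; rewrite mulrDr mulr1 (mulrC q) mulrN; lra.
by move=> x Bx; exact: edge_side_closure (bU _ Bx) UP.
Qed.

(* The sides that meet at a vertex see each other's far ends on the same side,
   so the orientation cannot change from one side to the next. *)
Theorem convex_polygon_orientation : exists c : R, [/\ c ^+ 2 = 1,
  forall i, 0 < c * turn s i & forall i j, 0 <= c * edge_side s i (vertex s j)].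
Proof.
have Bv j : boundary s (vertex s j) by exact: (side_boundary n0 (side_left s j)).
have turnP i j : 0 <= turn s i * edge_side s i (vertex s j).
  have [d d0 dP] := polygon_one_sided i.
  (* Testing at vertex [i.+2] shows that [d] has the sign of [turn s i]. *)
  have := dP _ (Bv i.+2); rewrite edge_sideS2 => h.
  have h2 : 0 < d * turn s i by rewrite lt0r h mulf_neq0.
  have d2 : 0 < d * d by rewrite -expr2 exprn_even_gt0//= d0.
  have := mulr_ge0 (ltW h2) (dP _ (Bv j)).
  by rewrite mulrACA pmulr_rge0.
have same i : 0 < turn s i * turn s i.+1.
  by have := turnP i.+1 i; rewrite edge_sideS_vertex lt0r mulf_neq0// mulrC.
have tt i : 0 < turn s i * turn s i by rewrite -expr2 exprn_even_gt0//= turnS.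
pose c := Num.sg (turn s 0).
have c2 : c ^+ 2 = 1 by rewrite sqr_sg turnS.
have cP i : 0 < c * turn s i.
  elim: i => [|i IH]; first by rewrite -normrEsg normr_gt0.
  have := mulr_gt0 IH (same i).
  have -> : c * turn s i * (turn s i * turn s i.+1)
      = (turn s i * turn s i) * (c * turn s i.+1) by ring.
  by rewrite (pmulr_rgt0 _ (tt i)).
exists c; split=> // i j.
have := mulr_ge0 (ltW (cP i)) (turnP i j).
have -> : c * turn s i * (turn s i * edge_side s i (vertex s j))
    = (turn s i * turn s i) * (c * edge_side s i (vertex s j)) by ring.
by rewrite (pmulr_rge0 _ (tt i)).
Qed.

End GlobalConvexity.

(** * Conversely, strictly convex vertex lists are convex polygons *)

Section StrictlyConvex.
Context {R : realType} (s : seq 'rV[R]_2).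
Context (s_gt2 : (2 < size s)%N).
Context (leftS : forall i j, (i < size s)%N -> (j < size s)%N -> j != i ->
  j != (i.+1 %% size s)%N -> 0 < edge_side s i (vertex s j)).
Implicit Types (x y z : 'rV[R]_2) (i j : nat).

Let n0 : (0 < size s)%N. Proof. exact: leq_ltn_trans s_gt2. Qed.

Lemma left_of_edge i j : j != i %[mod size s] -> j != i.+1 %[mod size s] ->
  0 < edge_side s i (vertex s j).
Proof.
move=> ji jiS; rewrite -edge_side_mod -vertex_mod; apply: leftS; rewrite ?ltn_mod//.
by rewrite -[(i %% _).+1]addn1 modnDml addn1.
Qed.

Lemma turn_gt0 i : 0 < turn s i.
Proof.
rewrite -edge_sideS2; apply: left_of_edge; apply/negP.
  by rewrite -{2}[i]addn0 -addn2 eqn_modDl mod0n modn_small.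
by rewrite -[i.+2]addn1 -{2}[i.+1]addn0 eqn_modDl mod0n modn_small// ltnW.
Qed.

Lemma strictly_convex_edge_neq0 i : edge s i != 0.
Proof.
by apply/eqP => e0; have := turn_gt0 i; rewrite /turn e0 /cross !mxE !mul0r subrr ltxx.
Qed.

Lemma strictly_convex_is_polygon : polygon s.
Proof.
by split=> // i; rewrite eq_sym -subr_eq0; exact: strictly_convex_edge_neq0.
Qed.

(** The next side leaves the line of side [i] at once, and a side not adjacent to it lies strictly
    to its left. *)
Lemma strictly_convex_simple : simple_polygon s.
Proof.
split=> [i _|i j ii jj ij ijS jiS].
  apply/seteqP; split=> [x [six sSx]|_ ->]; last first.
    by split; [exact: side_right|exact: side_left].
  have [t _ xE] := sideP sSx; move: (edge_side_on six).
  rewrite xE edge_sideD edge_side_vertexS add0r crossZr => /eqP.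
  rewrite mulf_eq0 -/(turn s i) (gt_eqF (turn_gt0 i)) orbF => /eqP ->.
  by rewrite scale0r addr0.
apply/seteqP; split=> // x [six [t /= + xE]]; rewrite in_itv/= => t01.
have p1 : 0 < edge_side s i (vertex s j).
  by apply: left_of_edge; rewrite !(modn_small jj) ?(modn_small ii)// eq_sym.
have p2 : 0 < edge_side s i (vertex s j.+1).
  apply: left_of_edge; first by rewrite (modn_small ii) eq_sym.
  by rewrite -addn1 -[i.+1]addn1 eqn_modDr !modn_small// eq_sym.
have := conv_gt0 t01 p1 p2.
by rewrite -edge_side_segment xE edge_side_on// ltxx.
Qed.

Definition polygon_interior :=
  [set x | forall i, (i < size s)%N -> 0 < edge_side s i x].

(** On the line of a side, the half planes of the two neighbouring sides leave only the side itself,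
    which belongs to the boundary. *)
Lemma interior_of_nonneg x : (forall i, 0 <= edge_side s i x) ->
  ~ boundary s x -> polygon_interior x.
Proof.
move=> xge0 nB i _; rewrite lt0r xge0 andbT; apply/eqP => xi; apply: nB.
wlog : i xi / exists k, i = k.+1 => [H|[k ik]].
  apply: (H (i + size s)%N); first by rewrite -edge_side_mod modnDr edge_side_mod.
  by exists (i + (size s).-1)%N; rewrite -addnS prednK.
rewrite {}ik in xi.
have [t xE] := edge_side_eq0 strictly_convex_is_polygon xi.
apply: (side_boundary n0 (i := k.+1)); rewrite xE; apply: in_side.
have := xge0 k; have := xge0 k.+2; rewrite xE !edge_sideD.
rewrite edge_sideS_vertex edge_side_vertexS add0r !crossZr (crossC (edge s k.+2)).
have := turn_gt0 k; have := turn_gt0 k.+1; rewrite -/(turn s k) -/(turn s k.+1).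
by move=> h1 h2 h3 h4; apply/andP; split; nra.
Qed.

Lemma open_polygon_interior : open polygon_interior.
Proof.
have -> : polygon_interior =
    ~` \bigcup_(i in `I_(size s)) [set x | edge_side s i x <= 0].
  apply/seteqP; split=> [x xin [i /= /xin + h]|x h i ii].
    by rewrite ltNge h.
  by rewrite ltNge; apply/negP => xi; apply: h; exists i.
apply/closed_openC/closed_bigcup => [|i _]; first exact: finite_II.
rewrite closure_id; apply/seteqP; split=> x; first exact: subset_closure.
move=> /(edge_side_closure (i := i) (d := -1)) h /=.
by rewrite -oppr_ge0 -mulN1r h// => y /=; rewrite mulN1r oppr_ge0.
Qed.

(** The edges of a closed polygon add up to zero, so the linear parts cancel; the constant is twice
    the signed area. *)
Lemma sum_edge_side x : \sum_(i < size s) edge_side s i x =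
  \sum_(i < size s) edge_side s i 0.
Proof.
have E (i : 'I_(size s)) : edge_side s i x = cross (edge s i) x + edge_side s i 0.
  by rewrite /edge_side /cross !mxE; ring.
rewrite (eq_bigr (fun i : 'I_(size s) => cross (edge s i) x + edge_side s i 0)) => [|i _];
  last exact: E.
rewrite big_split/= -[RHS]add0r; congr (_ + _).
have -> : \sum_(i < size s) cross (edge s i) x = cross (\sum_(i < size s) edge s i) x.
  elim/big_ind2 : _ => [|u a w b -> ->|//]; last by rewrite crossDl.
  by rewrite /cross !mxE !mul0r subrr.
rewrite -(big_mkord xpredT (edge s)) /edge telescope_sumr//.
by rewrite -[X in vertex s X - _]add0n vertex_size subrr /cross !mxE !mul0r subrr.
Qed.

Lemma interior_edge_side_le x i : polygon_interior x -> (i < size s)%N ->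
  edge_side s i x <= \sum_(i < size s) edge_side s i 0.
Proof.
move=> xin ii; rewrite -(sum_edge_side x) (bigD1 (Ordinal ii))//= lerDl.
by apply: sumr_ge0 => j _; apply/ltW/xin.
Qed.

(** Two of these functions, both bounded, serve as coordinates by [cross_decomposition]. *)
Lemma interior_bounded : bounded_set polygon_interior.
Proof.
set D := \sum_(i < size s) edge_side s i 0.
exists (`|vertex s 1| + D / turn s 0 * (`|edge s 0| + `|edge s 1|)).
split; first exact: num_real.
move=> M /ltW leM x xin; apply: le_trans leM.
have t0 := turn_gt0 0; have s1 : (1 < size s)%N by exact: ltnW.
have f0 := xin _ n0; have f1 := xin _ s1.
have g0 := interior_edge_side_le xin n0; have g1 := interior_edge_side_le xin s1.
have xE : x = vertex s 1 + ((edge_side s 0 x / turn s 0) *: edge s 1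
    - (edge_side s 1 x / turn s 0) *: edge s 0).
  apply/eqP; rewrite addrC -subr_eq; apply/eqP.
  have -> : edge_side s 0 x = cross (edge s 0) (x - vertex s 1).
    by rewrite -{1}(subrK (vertex s 1) x) addrC edge_sideD edge_side_vertexS add0r.
  by apply: cross_decomposition; rewrite gt_eqF.
rewrite [in leLHS]xE; apply: le_trans (ler_normD _ _) _; rewrite lerD2l.
apply: le_trans (ler_normB _ _) _; rewrite !normrZ mulrDr addrC.
have h a : 0 < a -> a <= D -> `|a| * `|(turn s 0)^-1| <= D / turn s 0.
  by move=> a0 aD; rewrite normfV !gtr0_norm// ler_pM2r// invr_gt0.
by apply: lerD; apply: ler_wpM2r => //; exact: h.
Qed.

(** The interior is open and closed in the complement of the boundary, so it contains the component
    of each of its points, which is then bounded. *)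
Lemma interior_inside : polygon_interior `<=` inside s.
Proof.
move=> x xin.
have nB y : polygon_interior y -> ~ boundary s y.
  by move=> yin [i ii /edge_side_on yi]; have := yin _ ii; rewrite yi ltxx.
split; first exact: nB.
set C := connected_component _ _.
suff CG : C `<=` polygon_interior.
  case: interior_bounded => M [Mr H]; exists M; split=> // M' MM' y Cy.
  exact/(H _ MM')/CG.
have CE : C `&` polygon_interior = C.
  apply: (@component_connected _ (~` boundary s) x).
  - by exists x; split=> //; apply: connected_component_refl; exact: nB.
  - by exists polygon_interior => //; exact: open_polygon_interior.
  - exists (closure polygon_interior); first exact: closed_closure.
    apply/seteqP; split=> y [Cy yin]; split=> //; first exact: subset_closure.
    apply: interior_of_nonneg; last exact: (connected_component_sub Cy).
    move=> i; rewrite -edge_side_mod -[leRHS]mul1r.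
    apply: (edge_side_closure yin) => z zin; rewrite mul1r.
    by apply/ltW/zin; rewrite ltn_mod.
by rewrite -CE => y [].
Qed.

Lemma strictly_convex_angle i :
  0 < angle (vertex s i) (vertex s i.+1) (vertex s i.+2) < pi.
Proof.
have [_ vS] := strictly_convex_is_polygon.
apply: angle_lt_pi => //; first by rewrite eq_sym.
by rewrite -opprB crossNl oppr_eq0; exact/lt0r_neq0/turn_gt0.
Qed.

Lemma ltn_modS i : (i < size s)%N -> exists k, i = (k.+1 %% size s)%N.
Proof.
move=> ii; exists (i + (size s).-1)%N.
by rewrite -addnS prednK// modnDr modn_small.
Qed.

Lemma strictly_convex_vertex_angle i : (i < size s)%N ->
  vertex_angle s i != 0 /\ vertex_angle s i != pi.
Proof.
move=> /ltn_modS[k ->]; rewrite vertex_angleS//.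
by have /andP[h1 h2] := strictly_convex_angle k; rewrite gt_eqF ?lt_eqF.
Qed.

(** For the two sides at the vertex the value is a positive multiple of [turn s i]; for any other
    side it is positive at the vertex and stays so for small [e]. *)
Lemma bisector_interior i : \forall e \near 0^'+, polygon_interior
  (vertex s i.+1 + e *: (unit_vec (- edge s i) + unit_vec (edge s i.+1))).
Proof.
set b := unit_vec _ + _.
suff H (j : 'I_(size s)) :
    \forall e \near 0^'+, 0 < edge_side s j (vertex s i.+1 + e *: b).
  by apply: (filterS _ (filter_forall _ H)) => e He j jj; exact: (He (Ordinal jj)).
have E k : 0 < (enorm (edge s k))^-1.
  by rewrite invr_gt0 enorm_gt0// strictly_convex_edge_neq0.
have EN : enorm (- edge s i) = enorm (edge s i).
  by rewrite /enorm; congr Num.sqrt; rewrite !edotE !mxE; ring.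
have [ji|ji] := eqVneq (j %% size s)%N (i %% size s)%N.
  near=> e; have e0 : 0 < e by near: e; exact: nbhs_right_gt.
  rewrite -edge_side_mod ji edge_side_mod edge_sideD edge_side_vertexS add0r.
  rewrite /b /unit_vec crossZr crossDr !crossZr crossNr crossvv oppr0 mulr0 add0r.
  by rewrite -/(turn s i) !mulr_gt0// turn_gt0.
have [jiS|jiS] := eqVneq (j %% size s)%N (i.+1 %% size s)%N.
  near=> e; have e0 : 0 < e by near: e; exact: nbhs_right_gt.
  rewrite -edge_side_mod jiS edge_side_mod edge_sideD edge_side_vertex add0r.
  rewrite /b /unit_vec EN crossZr crossDr !crossZr crossNr crossvv mulr0 addr0.
  by rewrite crossC opprK -/(turn s i) !mulr_gt0// turn_gt0.
have p : 0 < edge_side s j (vertex s i.+1).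
  apply: left_of_edge; first by rewrite eq_sym.
  by rewrite -[i.+1]addn1 -[j.+1]addn1 eqn_modDr eq_sym.
have N0 : 0 < `|cross (edge s j) b| + 1 by rewrite ltr_wpDl.
near=> e; have e0 : 0 < e by near: e; exact: nbhs_right_gt.
have : e < edge_side s j (vertex s i.+1) / (`|cross (edge s j) b| + 1).
  by near: e; apply: nbhs_right_lt; rewrite divr_gt0.
rewrite ltr_pdivlMr// => h; rewrite edge_sideD crossZr.
have := lerNnormlW (lexx `|cross (edge s j) b|).
by nra.
Unshelve. all: by end_near. Qed.

Lemma strictly_convex_interior_angle i : (i < size s)%N -> interior_angle s i < pi.
Proof.
move=> /ltn_modS[k ->].
rewrite /interior_angle vertex_angleS// prev_vertex_mod prev_vertexS//.
rewrite vertex_mod vertexS_mod.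
rewrite -(opprB (vertex s k.+1)) -/(edge s k) -/(edge s k.+1).
case: asboolP => [_|[]]; first by have /andP[] := strictly_convex_angle k.
by apply: (filterS _ (bisector_interior k)) => e; exact: interior_inside.
Qed.

Lemma strictly_convex_convex_polygon : convex_polygon s.
Proof.
split; [exact: strictly_convex_is_polygon|exact: strictly_convex_simple|].
exact: strictly_convex_interior_angle.
Qed.

End StrictlyConvex.

(** * Balanced sums of squares of consecutive integers *)

Lemma sum_squares_balance_short a k n : (0 < k < n)%N ->
  (\sum_(0 <= j < k) (a + j) ^ 2 = \sum_(k <= j < n) (a + j) ^ 2)%N -> (n < k + k)%N.
Proof.
move=> /andP[k0 kn] E; rewrite ltnNge; apply/negP => kkn; move: E.
(* If [k + k <= n], the [k] terms that follow already exceed the first [k] ones, pair by pair and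
   strictly for the first pair. *)
rewrite (@big_cat_nat _ _ _ (k + k) k n)//= ?leq_addr// -{2}[k]add0n big_addn addnK.
apply/eqP; rewrite ltn_eqF//; apply: (@leq_trans (\sum_(0 <= j < k) (a + (j + k)) ^ 2)).
  rewrite !big_mkord -addn1; case: k k0 kn kkn => // k _ _ _.
  rewrite big_ord_recl [leqRHS]big_ord_recl/= addnAC; apply: leq_add.
    by rewrite addn0 add0n addn1 ltn_exp2r// -addn1 leq_add2l.
  by apply: leq_sum => j _; rewrite leq_exp2r// leq_add2l leq_addr.
by rewrite leq_addr.
Qed.

(** Fewer but larger squares can balance the first [k] only for small [a], which leaves a finite
    search. *)
Lemma sum_squares_balance_solutions a k n : (0 < a)%N -> (0 < k < n)%N -> (k <= 6)%N ->
  (\sum_(0 <= j < k) (a + j) ^ 2 = \sum_(k <= j < n) (a + j) ^ 2)%N ->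
  (k, n, a) \in
    [:: (2, 3, 3)%N; (3, 5, 10)%N; (4, 7, 21)%N; (5, 9, 36)%N; (6, 11, 55)%N].
Proof.
move=> a0 kn k6 E; have n2k := sum_squares_balance_short kn E.
have [m nE] : exists m, n = (k + m)%N by exists (n - k)%N; lia.
move: kn n2k E; rewrite {n}nE => /andP[k0 m0]; rewrite ltn_add2l => mk.
have {}m0 : (0 < m)%N by lia.
rewrite -{2}[k]add0n big_addn addKn => E.
(* With [k <= 6] and [m < k], the later offsets are at most 10, so
   [k * a ^ 2 <= (k - 1) * (a + 10) ^ 2]; the weakest bound comes from [k = 6]. *)
have a105 : (a <= 105)%N.
  have h1 : (k * a ^ 2 <= \sum_(0 <= j < k) (a + j) ^ 2)%N.
    rewrite -[X in (X * _ <= _)%N]subn0 -sum_nat_const_nat; apply: leq_sum => j _.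
    by rewrite leq_exp2r// leq_addr.
  have h2 : (\sum_(0 <= j < m) (a + (j + k)) ^ 2 <= m * (a + 10) ^ 2)%N.
    rewrite -[X in (_ <= X * _)%N]subn0 -sum_nat_const_nat !big_mkord.
    by apply: leq_sum => j _; rewrite leq_exp2r// leq_add2l; have := ltn_ord j; lia.
  rewrite E in h1; have := leq_trans h1 h2.
  have : (m * (a + 10) ^ 2 <= k.-1 * (a + 10) ^ 2)%N.
    by rewrite leq_mul2r; apply/orP; right; lia.
  move=> h3 h4; have := leq_trans h4 h3; rewrite -!mulnn.
  clear E h1 h2 h3 h4 mk.
  by move: k6 k0; case: k => [|[|[|[|[|[|[|k]]]]]]] //= _ _; nia.
pose chk := all (fun k => all (fun m => all (fun a =>
  (sumn [seq (a + j) * (a + j) | j <- iota 0 k] ==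
   sumn [seq (a + (j + k)) * (a + (j + k)) | j <- iota 0 m]) ==>
  ((k, k + m, a) \in
    [:: (2, 3, 3)%N; (3, 5, 10)%N; (4, 7, 21)%N; (5, 9, 36)%N; (6, 11, 55)%N]))
  (iota 1 105)) (iota 1 k.-1)) (iota 1 6).
have C : chk by vm_compute.
have /allP := C => /(_ k); rewrite mem_iota => /(_ _)/allP.
move=> /(_ ltac:(lia) m); rewrite mem_iota => /(_ ltac:(lia))/allP/(_ a).
rewrite mem_iota => /(_ ltac:(lia))/implyP; apply.
by move/eqP: E; rewrite /index_iota !subn0 !sumnE !big_map.
Qed.

(** * Paths in coordinates: [O] at the origin, first side on the first axis, counterclockwise *)

Section ArithmeticPath.
Context {R : realType} (n a : nat) (X Y : nat -> R).
Implicit Types (i j k : nat).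

Let r i : R := X i ^+ 2 + Y i ^+ 2.

Context (a_gt0 : (0 < a)%N) (n_gt2 : (2 < n)%N).
Context (X0 : X 0 = 0) (Y0 : Y 0 = 0) (Xn : X n = 0) (Yn : Y n = 0).
Context (X1 : X 1 = a%:R) (Y1 : Y 1 = 0).
Context (len : forall i, (i < n)%N ->
  (X i.+1 - X i) ^+ 2 + (Y i.+1 - Y i) ^+ 2 = (a + i)%:R ^+ 2).
Context (perp : forall i, (i < n)%N ->
  X i * (X i.+1 - X i) + Y i * (Y i.+1 - Y i) = 0 \/
  X i.+1 * (X i.+1 - X i) + Y i.+1 * (Y i.+1 - Y i) = 0).
Context (turn0 : forall i, (i.+1 < n)%N ->
  (X i.+1 - X i) * (Y i.+2 - Y i.+1) - (Y i.+1 - Y i) * (X i.+2 - X i.+1) != 0).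
Context (nz : forall i, (0 < i < n)%N -> 0 < X i ^+ 2 + Y i ^+ 2).
Context (up : forall i, (i <= n)%N -> 0 <= Y i).
Context (ccw : forall i, (i < n)%N -> 0 <= X i * Y i.+1 - Y i * X i.+1).

(* If the triangles O v_i v_{i+1} and O v_{i+1} v_{i+2} both had their right angle
   at v_{i+1}, the two sides at v_{i+1} would be aligned. *)
Lemma right_angle_switch : exists k, [/\ (0 < k < n)%N,
  forall i, (i < k)%N -> X i * (X i.+1 - X i) + Y i * (Y i.+1 - Y i) = 0 &
  forall i, (k <= i < n)%N ->
    X i.+1 * (X i.+1 - X i) + Y i.+1 * (Y i.+1 - Y i) = 0].
Proof.
pose M i := X i.+1 * (X i.+1 - X i) + Y i.+1 * (Y i.+1 - Y i) == 0.
have ex : exists i, M i.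
  by exists n.-1; rewrite /M prednK ?Xn ?Yn ?mul0r ?addr0//; lia.
have Mn1 : M n.-1 by rewrite /M prednK ?Xn ?Yn ?mul0r ?addr0//; lia.
(* The first index whose triangle has its right angle at the far end; the last index qualifies
   because the path returns to [O]. *)
exists (ex_minn ex); case: ex_minnP => k Mk kmin.
have kn : (k <= n.-1)%N by exact: kmin.
split.
- rewrite lt0n; apply/andP; split; last by lia.
  apply/eqP => k0; move: Mk; rewrite k0 /M X0 Y0 X1 Y1 !subr0 mulr0 addr0.
  by rewrite mulf_eq0 orbb pnatr_eq0; lia.
- move=> i ik; have iN : (i < n)%N by lia.
  have [//|Mi] := perp iN.
  by have := kmin i; rewrite /M Mi eqxx => /(_ isT); lia.
move=> i /andP[ki]; elim: i ki => [|i IH] ki iN.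
  by move: ki; rewrite leqn0 => /eqP k0; apply/eqP; rewrite -[0%N]k0.
have [kE|ki'] : k = i.+1 \/ (k <= i)%N by lia.
  by apply/eqP; rewrite -kE.
have {}IH := IH ki' (ltnW iN).
have [P|//] := perp iN; exfalso.
have i1 : (0 < i.+1 < n)%N by [].
have := nz i1; move/eqP: (turn0 iN); rewrite /r; move: IH P.
set x := X i.+1; set y := Y i.+1; set dx := x - X i; set dy := y - Y i.
set ex' := X i.+2 - x; set ey := Y i.+2 - y => h1 h2 h3 h4.
(* Both sides at the vertex are perpendicular to its position vector, so each coordinate times the
   turn vanishes. *)
have E1 : x * (dx * ey - dy * ex') = 0.
  have -> : x * (dx * ey - dy * ex') =
    ey * (x * dx + y * dy) - dy * (x * ex' + y * ey) by ring.
  by rewrite h1 h2 !mulr0 subrr.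
have E2 : y * (dx * ey - dy * ex') = 0.
  have -> : y * (dx * ey - dy * ex') =
    dx * (x * ex' + y * ey) - ex' * (x * dx + y * dy) by ring.
  by rewrite h1 h2 !mulr0 subrr.
move/eqP: E1 => /[!mulf_eq0] /orP[]/eqP x0; last by apply: h3.
move/eqP: E2 => /[!mulf_eq0] /orP[]/eqP y0; last by apply: h3.
by move: h4; rewrite x0 y0 expr0n addr0 ltxx.
Qed.

Section RightAngleSwitch.
Context (k : nat) (k_range : (0 < k < n)%N).
Context (footL : forall i, (i < k)%N ->
  X i * (X i.+1 - X i) + Y i * (Y i.+1 - Y i) = 0).
Context (footR : forall i, (k <= i < n)%N ->
  X i.+1 * (X i.+1 - X i) + Y i.+1 * (Y i.+1 - Y i) = 0).

(** Pythagoras with the right angle at the near end, where the side is a leg. After the switch the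
    distance is the hypotenuse at the near end, and the sum is counted back from [O]. *)
Lemma sqr_radius_up i : (i <= k)%N -> r i = (\sum_(0 <= j < i) (a + j) ^ 2)%:R.
Proof.
elim: i => [|i IH] ik; first by rewrite big_geq// /r X0 Y0 expr0n addr0.
rewrite big_nat_recr//= natrD -IH ?(ltnW ik)// natrX -len; last by lia.
have := footL ik; rewrite /r; set x := X i; set x' := X i.+1.
by set y := Y i; set y' := Y i.+1 => E; lra.
Qed.

Lemma sqr_radius_down i : (k <= i <= n)%N ->
  r i = (\sum_(i <= j < n) (a + j) ^ 2)%:R.
Proof.
move=> /andP[ki iN]; move: {-2}(n - i)%N (erefl (n - i)%N) => m.
elim: m i ki iN => [|m IH] i ki iN mE.
  have -> : i = n by lia.
  by rewrite big_geq// /r Xn Yn expr0n addr0.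
rewrite big_ltn; last by lia.
have kin : (k <= i < n)%N by lia.
rewrite natrD -(IH i.+1) ?natrX -?len; try lia.
have := footR kin; rewrite /r; set x := X i; set x' := X i.+1.
by set y := Y i; set y' := Y i.+1 => E; lra.
Qed.

Lemma sum_squares_balance :
  (\sum_(0 <= j < k) (a + j) ^ 2 = \sum_(k <= j < n) (a + j) ^ 2)%N.
Proof.
apply/eqP; rewrite -(eqr_nat R) -sqr_radius_up// -sqr_radius_down//.
by lia.
Qed.

(** The side is perpendicular to the position vector of its near end, hence [l] times its quarter
    turn; [l] is the tangent of the angle at [O], nonnegative by [ccw]. *)
Lemma rotate_up i : (0 < i < k)%N -> exists l, [/\ 0 <= l,
  l ^+ 2 * r i = (a + i)%:R ^+ 2, X i.+1 = X i - l * Y i & Y i.+1 = Y i + l * X i].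
Proof.
move=> /andP[i0 ik]; have iN : (i < n)%N by lia.
have ri : 0 < r i by apply: nz; rewrite i0.
have := len iN; have := footL ik; have := ccw iN; rewrite /r in ri *.
move: ri; set x := X i; set x' := X i.+1; set y := Y i; set y' := Y i.+1.
move=> ri c0 p L; have rn0 : x ^+ 2 + y ^+ 2 != 0 by rewrite gt_eqF.
have E1 : (x ^+ 2 + y ^+ 2) * (x' - x) = - ((x * y' - y * x') * y).
  transitivity (x * (x * (x' - x) + y * (y' - y)) - ((x * y' - y * x') * y)).
    by ring.
  by rewrite p mulr0 sub0r.
have E2 : (x ^+ 2 + y ^+ 2) * (y' - y) = (x * y' - y * x') * x.
  transitivity (y * (x * (x' - x) + y * (y' - y)) + ((x * y' - y * x') * x)).
    by ring.
  by rewrite p mulr0 add0r.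
have D1 : x' - x = - ((x * y' - y * x') / (x ^+ 2 + y ^+ 2) * y).
  by apply: (mulfI rn0); rewrite E1; field.
have D2 : y' - y = (x * y' - y * x') / (x ^+ 2 + y ^+ 2) * x.
  by apply: (mulfI rn0); rewrite E2; field.
exists ((x * y' - y * x') / (x ^+ 2 + y ^+ 2)); split.
- by rewrite divr_ge0// ltW.
- by rewrite -L D1 D2; ring.
- by rewrite -D1; ring.
- by rewrite -D2; ring.
Qed.

(** Here the side is [l] times the quarter turn of the position of its far end; solving for that end
    produces the factor [1 + l ^+ 2]. *)
Lemma rotate_down i : (k <= i)%N -> (i.+1 < n)%N -> exists l, [/\ 0 <= l,
  l ^+ 2 * r i.+1 = (a + i)%:R ^+ 2,
  (1 + l ^+ 2) * X i.+1 = X i - l * Y i & (1 + l ^+ 2) * Y i.+1 = Y i + l * X i].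
Proof.
move=> ki iN'; have iN : (i < n)%N by lia.
have ri : 0 < r i.+1 by apply: nz.
have kin : (k <= i < n)%N by lia.
have := len iN; have := footR kin; have := ccw iN; rewrite /r in ri *.
move: ri; set x := X i; set x' := X i.+1; set y := Y i; set y' := Y i.+1.
move=> ri c0 p L; have rn0 : x' ^+ 2 + y' ^+ 2 != 0 by rewrite gt_eqF.
have E1 : (x' ^+ 2 + y' ^+ 2) * (x' - x) = - ((x * y' - y * x') * y').
  transitivity (x' * (x' * (x' - x) + y' * (y' - y)) - ((x * y' - y * x') * y')).
    by ring.
  by rewrite p mulr0 sub0r.
have E2 : (x' ^+ 2 + y' ^+ 2) * (y' - y) = (x * y' - y * x') * x'.
  transitivity (y' * (x' * (x' - x) + y' * (y' - y)) + ((x * y' - y * x') * x')).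
    by ring.
  by rewrite p mulr0 add0r.
set l := (x * y' - y * x') / (x' ^+ 2 + y' ^+ 2).
have D1 : x' - x = - (l * y') by apply: (mulfI rn0); rewrite E1 /l; field.
have D2 : y' - y = l * x' by apply: (mulfI rn0); rewrite E2 /l; field.
exists l; split.
- by rewrite divr_ge0// ltW.
- by rewrite -L D1 D2; ring.
- have -> : x = x' + l * y' by rewrite -[l * y']opprK -D1; ring.
  have -> : y = y' - l * x' by rewrite -D2; ring.
  by ring.
- have -> : x = x' + l * y' by rewrite -[l * y']opprK -D1; ring.
  have -> : y = y' - l * x' by rewrite -D2; ring.
  by ring.
Qed.

(* Up to a positive factor, v_{i+1} is v_i turned by an angle of tangent at
   least l. *)
Definition turned i (l : R) := exists m rho, [/\ l <= m, 0 < rho,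
  rho * X i.+1 = X i - m * Y i & rho * Y i.+1 = Y i + m * X i].

(** The sides before side [i] are shorter than it, so [r i <= i * (a + i) ^ 2] and the tangent is at
    least [1 / sqrt i]. *)
Lemma turned_up i l : (0 < i < k)%N -> 0 <= l -> l ^+ 2 * i%:R <= 1 -> turned i l.
Proof.
move=> ik l0 li; have [m [m0 mr mX mY]] := rotate_up ik.
exists m, 1; split=> //; rewrite ?mul1r//.
rewrite -ler_sqr ?nnegrE//.
have ri : 0 < r i by apply: nz; lia.
rewrite -(ler_pM2r ri) mr.
have rle : r i <= i%:R * (a + i)%:R ^+ 2.
  rewrite sqr_radius_up; last by lia.
  rewrite -natrX -natrM ler_nat -[X in (_ <= X * _)%N]subn0 -sum_nat_const_nat.
  rewrite !big_mkord; apply: leq_sum => j _.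
  by rewrite leq_exp2r// leq_add2l ltnW.
have L0 : 0 <= (a + i)%:R ^+ 2 :> R by rewrite sqr_ge0.
have l2 : 0 <= l ^+ 2 by rewrite sqr_ge0.
apply: (@le_trans _ _ (l ^+ 2 * (i%:R * (a + i)%:R ^+ 2))); first by rewrite ler_wpM2l.
by rewrite mulrA ler_piMl.
Qed.

Lemma turned_down i l : (k <= i)%N -> (i.+1 < n)%N -> 0 <= l ->
  l ^+ 2 * (\sum_(i.+1 <= j < n) (a + j) ^ 2)%:R <= (a + i)%:R ^+ 2 -> turned i l.
Proof.
move=> ki iN l0; rewrite -sqr_radius_down; last by lia.
move=> lr; have [m [m0 mr mX mY]] := rotate_down ki iN.
exists m, (1 + m ^+ 2); split=> //; last by rewrite ltr_wpDr// sqr_ge0.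
rewrite -ler_sqr ?nnegrE//.
have ri : 0 < r i.+1 by apply: nz; lia.
by rewrite -(ler_pM2r ri) mr.
Qed.

(** At height zero the bound would put the point on the negative half-axis, and a further turn would
    take it below, against [up]. *)
Lemma turned_height_gt0 i l t : (0 < i < n)%N -> 0 < l -> turned i l ->
  X i <= t * Y i -> 0 < Y i.
Proof.
move=> iN l0 [m [rho [lm rho0 _ EY]]] Xt.
have iN' : (i < n)%N by case/andP: iN.
rewrite lt0r up ?(ltnW iN')// andbT; apply/eqP => y0.
have := nz iN; rewrite /r y0 expr0n addr0 => x2.
have xn0 : X i != 0 by rewrite -sqrf_eq0 gt_eqF.
have xneg : X i < 0 by rewrite lt_neqAle xn0; move: Xt; rewrite y0 mulr0.
have := up iN'; rewrite -(pmulr_rge0 _ rho0) EY y0 add0r.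
by rewrite pmulr_rge0 ?leNgt ?xneg//; exact: lt_le_trans lm.
Qed.

(** For an angle of cotangent [t] and one of tangent [l], the sum has cotangent
    [(t - l) / (1 + t * l)]; the last condition says that [t'] is at least this, without the
    division. *)
Lemma cot_step i l t t' : (0 < i < n)%N -> 0 < l -> turned i l ->
  X i <= t * Y i -> 0 <= Y i + t' * X i -> 0 <= 1 - t' * l ->
  t - l <= t' * (1 + t * l) -> X i.+1 <= t' * Y i.+1.
Proof.
move=> iN l0 ti Xt h1 h2 h3; have Y0' := turned_height_gt0 iN l0 ti Xt.
have [m [rho [lm rho0 EX EY]]] := ti.
rewrite -(ler_pM2l rho0) mulrCA EX EY.
(* The claim is the sum of [g1], [g2] and [g3]. *)
have g1 : 0 <= (m - l) * (Y i + t' * X i) by rewrite mulr_ge0// subr_ge0.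
have g2 : 0 <= (1 - t' * l) * (t * Y i - X i) by rewrite mulr_ge0// subr_ge0.
have g3 : 0 <= (t' * (1 + t * l) - (t - l)) * Y i by rewrite mulr_ge0 ?subr_ge0// ltW.
by lra.
Qed.

(** When [t'] is not positive, the two sign conditions of [cot_step] follow from
    [0 <= 1 + t * t']. *)
Lemma cot_step_neg i l t t' : (0 < i < n)%N -> 0 < l -> turned i l ->
  X i <= t * Y i -> t' <= 0 -> 0 <= 1 + t * t' ->
  t - l <= t' * (1 + t * l) -> X i.+1 <= t' * Y i.+1.
Proof.
move=> iN l0 ti Xt t'0 tt' h3; have Y0' := turned_height_gt0 iN l0 ti Xt.
apply: (cot_step iN l0 ti Xt) => //.
- have g1 : 0 <= - t' * (t * Y i - X i) by rewrite mulr_ge0 ?subr_ge0 ?oppr_ge0.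
  have g2 : 0 <= (1 + t * t') * Y i by rewrite mulr_ge0// ltW.
  by lra.
- have : 0 <= - t' * l by rewrite mulr_ge0 ?oppr_ge0// ltW.
  by lra.
Qed.

(** A negative [1 + t * l] means that the total angle exceeds [pi], so the next vertex would lie
    below the axis. *)
Lemma cot_overturn i l t : (0 < i < n)%N -> 0 < l -> turned i l ->
  X i <= t * Y i -> 1 + t * l < 0 -> False.
Proof.
move=> iN l0 ti Xt h; have Y0' := turned_height_gt0 iN l0 ti Xt.
have [m [rho [lm rho0 _ EY]]] := ti.
have iN' : (i < n)%N by case/andP: iN.
have := up iN'; rewrite -(pmulr_rge0 _ rho0) EY.
have t0 : t < 0 by nra.
have g1 : 0 <= m * (t * Y i - X i).
  by rewrite mulr_ge0 ?subr_ge0// (le_trans _ lm)// ltW.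
have g2 : 0 <= (m - l) * - t * Y i.
  by rewrite !mulr_ge0 ?subr_ge0 ?oppr_ge0 ?(ltW t0)// ltW.
have g3 : 0 < - (1 + t * l) * Y i by rewrite mulr_gt0// oppr_gt0.
by lra.
Qed.

(** Here [v_2] is [(a, a + 1)], since the second side is perpendicular to the first. *)
Lemma cot2 : (1 < k)%N -> X 2 <= 1 * Y 2.
Proof.
move=> k1; have [|l [l0 lr -> ->]] := @rotate_up 1; first by rewrite k1.
move: lr; rewrite /r X1 Y1 expr0n addr0 mulr0 subr0 add0r mul1r -exprMn.
have a0 : 0 < a%:R :> R by rewrite ltr0n.
move=> E; have : l * a%:R = (a + 1)%:R.
  by apply/eqP; rewrite -(@eqrXn2 _ 2) ?E ?mulr_ge0// ltW.
by move=> ->; rewrite ler_nat leq_addr.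
Qed.

(* The bounds on cot (arg v_i) add up the angles arg v_{i+1} - arg v_i, whose
   tangent is at least 1 / sqrt i as the sides get longer; 1 / sqrt i is rounded
   down to a rational number. *)
Lemma cot3 : (2 < k)%N -> X 3 <= 9 / 50 * Y 3.
Proof.
move=> k2; have k1 := ltnW k2; have i2 : (0 < 2 < n)%N by lia.
have t2 : turned 2 (7 / 10) by apply: turned_up; [lia|lra|lra].
(* The new bound rounds up [(1 - 7 / 10) / (1 + 7 / 10)]. As it is positive, [cot_step_neg] does not
   apply and one sign is checked on the coordinates. *)
apply: (cot_step i2 _ t2 (cot2 k1)); try lra.
have [|l [l0 lr -> ->]] := @rotate_up 1; first by rewrite k1.
rewrite X1 Y1 mulr0 subr0 add0r.
by have := mulr_ge0 l0 (ler0n R a); have := ler0n R a; lra.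
Qed.

Lemma cot4 : (3 < k)%N -> X 4 <= - (7 / 20) * Y 4.
Proof.
move=> k3; have i3 : (0 < 3 < n)%N by lia.
have t3 : turned 3 (4 / 7) by apply: turned_up; [lia|lra|lra].
by apply: (cot_step_neg i3 _ t3 (cot3 (ltnW k3))); lra.
Qed.

Lemma cot5 : (4 < k)%N -> X 5 <= - 1 * Y 5.
Proof.
move=> k4; have i4 : (0 < 4 < n)%N by lia.
have t4 : turned 4 (1 / 2) by apply: turned_up; [lia|lra|lra].
by apply: (cot_step_neg i4 _ t4 (cot4 (ltnW k4))); lra.
Qed.

Lemma cot6 : (5 < k)%N -> X 6 <= - (13 / 5) * Y 6.
Proof.
move=> k5; have i5 : (0 < 5 < n)%N by lia.
have t5 : turned 5 (4 / 9) by apply: turned_up; [lia|lra|lra].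
by apply: (cot_step_neg i5 _ t5 (cot5 (ltnW k5))); lra.
Qed.

(** One more turn beyond [v_6], of tangent at least [2 / 5], would bring the angle past [pi], as
    [1 - 13 / 5 * (2 / 5) < 0]. *)
Lemma switch_le6 : (k <= 6)%N.
Proof.
rewrite leqNgt; apply/negP => k6; have i6 : (0 < 6 < n)%N by lia.
have t6 : turned 6 (2 / 5) by apply: turned_up; [lia|lra|lra].
by apply: (cot_overturn i6 _ t6 (cot6 (ltnW k6))); lra.
Qed.

Lemma arithmetic_path_switch_classification :
  [/\ n = 3%N, X 1 = 3, Y 1 = 0, X 2 = 3 & Y 2 = 4] \/
  let l := 12 / Num.sqrt 221 in
  [/\ n = 5%N, X 1 = 10, Y 1 = 0, X 2 = 10 /\ Y 2 = 11 &
   [/\ X 3 = 10 - l * 11, Y 3 = 11 + l * 10,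
   X 4 = 196 / 365 * (X 3 - 13 / 14 * Y 3) & Y 4 = 196 / 365 * (Y 3 + 13 / 14 * X 3)]].
Proof.
have sqrE (x y : R) : 0 <= x -> 0 <= y -> x ^+ 2 = y ^+ 2 -> x = y.
  by move=> x0 y0 xy; apply/eqP; rewrite -(@eqrXn2 _ 2) ?xy.
have := sum_squares_balance_solutions a_gt0 k_range switch_le6 sum_squares_balance.
rewrite !inE => /or4P[| | |/orP[]] /eqP[kE nE aE].
- left; have [|l [l0 lr lX lY]] := @rotate_up 1; first by rewrite kE.
  move: lr lX lY; rewrite /r X1 Y1 aE => lr lX lY.
  have l43 : l = 4 / 3 by apply: sqrE => //; lra.
  by rewrite lX lY l43; split=> //; lra.
- right; have [|l [l0 lr lX lY]] := @rotate_up 1; first by rewrite kE.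
  move: lr lX lY; rewrite /r X1 Y1 aE => lr lX lY.
  have lE : l = 11 / 10 by apply: sqrE => //; lra.
  have X2 : X 2 = 10 by rewrite lX lE; lra.
  have Y2 : Y 2 = 11 by rewrite lY lE; lra.
  have [|m [m0 mr mX mY]] := @rotate_up 2; first by rewrite kE.
  move: mr mX mY; rewrite /r X2 Y2 aE => mr mX mY.
  (* The squared distance is now [10 ^ 2 + 11 ^ 2 = 221] and the side has length 12. *)
  have mE : m = 12 / Num.sqrt 221.
    apply: sqrE => //.
    by rewrite expr_div_n sqr_sqrtr; lra.
  have [||p [p0 pr pX pY]] := @rotate_down 3; rewrite ?kE ?nE//.
  (* Only the side of length 14 remains from here to [O]. *)
  have r4 : r 4 = 196.
    rewrite sqr_radius_down ?kE ?nE// aE big_nat1; lra.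
  move: pr pX pY; rewrite r4 aE => pr pX pY.
  have pE : p = 13 / 14 by apply: sqrE => //; lra.
  (* With this tangent, [1 + p ^+ 2] is [365 / 196]. *)
  rewrite pE in pX pY; rewrite /= -mE.
  by split=> //; split=> //; lra.
(* For sides 21 to 27, the tangents [25 / sqrt (26 ^ 2 + 27 ^ 2)] and [26 / 27], rounded down, take
   the angle beyond [pi]. *)
- exfalso.
  have t4 : turned 4 (33 / 50).
    apply: turned_down; rewrite ?kE ?nE//.
    rewrite big_ltn// big_ltn// big_geq// aE; lra.
  have t5 : turned 5 (24 / 25).
    apply: turned_down; rewrite ?kE ?nE//.
    rewrite big_nat1 aE; lra.
  have i4 : (0 < 4 < n)%N by rewrite nE.
  have i5 : (0 < 5 < n)%N by rewrite nE.
  have c4 : X 4 <= - (7 / 20) * Y 4 by apply: cot4; rewrite kE.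
  have c5 : X 5 <= - (13 / 10) * Y 5 by apply: (cot_step_neg i4 _ t4 c4); lra.
  by apply: (cot_overturn i5 _ t5 c5); lra.
(* Sides 36 to 44: again two turns after the switch exceed [pi]. *)
- exfalso.
  have t5 : turned 5 (11 / 20).
    apply: turned_down; rewrite ?kE ?nE//.
    rewrite big_ltn// big_ltn// big_ltn// big_geq// aE; lra.
  have t6 : turned 6 (17 / 25).
    apply: turned_down; rewrite ?kE ?nE//.
    rewrite big_ltn// big_ltn// big_geq// aE; lra.
  have i5 : (0 < 5 < n)%N by rewrite nE.
  have i6 : (0 < 6 < n)%N by rewrite nE.
  have c5 : X 5 <= - 1 * Y 5 by apply: cot5; rewrite kE.
  have c6 : X 6 <= - (17 / 5) * Y 6 by apply: (cot_step_neg i5 _ t5 c5); lra.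
  by apply: (cot_overturn i6 _ t6 c6); lra.
(* Sides 55 to 65: a single turn after the switch is enough. *)
- exfalso.
  have t6 : turned 6 (12 / 25).
    apply: turned_down; rewrite ?kE ?nE//.
    rewrite big_ltn// big_ltn// big_ltn// big_ltn// big_geq// aE; lra.
  have i6 : (0 < 6 < n)%N by rewrite nE.
  have c6 : X 6 <= - (13 / 5) * Y 6 by apply: cot6; rewrite kE.
  by apply: (cot_overturn i6 _ t6 c6); lra.
Qed.

End RightAngleSwitch.

Lemma arithmetic_path_classification :
  [/\ n = 3%N, X 1 = 3, Y 1 = 0, X 2 = 3 & Y 2 = 4] \/
  let l := 12 / Num.sqrt 221 in
  [/\ n = 5%N, X 1 = 10, Y 1 = 0, X 2 = 10 /\ Y 2 = 11 &
   [/\ X 3 = 10 - l * 11, Y 3 = 11 + l * 10,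
   X 4 = 196 / 365 * (X 3 - 13 / 14 * Y 3) & Y 4 = 196 / 365 * (Y 3 + 13 / 14 * X 3)]].
Proof.
have [k [k_range footL footR]] := right_angle_switch.
exact: (arithmetic_path_switch_classification k_range footL footR).
Qed.

End ArithmeticPath.

(** * The two polygons *)

Section Examples.
Context {R : realType}.
Implicit Types (s : seq 'rV[R]_2) (u w : 'rV[R]_2).

Definition pt (x y : R) : 'rV[R]_2 := \row_j (if j == 0 then x else y).

Lemma pt0 x y : pt x y 0 0 = x. Proof. by rewrite mxE. Qed.

Lemma pt1 x y : pt x y 0 1 = y. Proof. by rewrite mxE. Qed.

Lemma edot_pt x y x' y' : edot (pt x y) (pt x' y') = x * x' + y * y'.
Proof. by rewrite edotE !pt0 !pt1. Qed.

Lemma cross_pt x y x' y' : cross (pt x y) (pt x' y') = x * y' - y * x'.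
Proof. by rewrite /cross !pt0 !pt1. Qed.

Lemma ptB x y x' y' : pt x y - pt x' y' = pt (x - x') (y - y').
Proof. by apply: rV2P; rewrite !mxE. Qed.

Lemma enorm_eq u (a : R) : 0 <= a -> edot u u = a ^+ 2 -> enorm u = a.
Proof. by move=> a0 E; rewrite /enorm E sqrtr_sqr ger0_norm. Qed.

(** This reduces the definition to finitely many conditions on coordinates, free of angles and
    components. *)
Lemma convex_arithmetic_polygon_intro s a : (2 < size s)%N ->
  (forall i j, (i < size s)%N -> (j < size s)%N -> j != i ->
     j != (i.+1 %% size s)%N -> 0 < edge_side s i (vertex s j)) ->
  (forall i, (i < size s)%N -> edot (edge s i) (edge s i) = (a + i)%:R ^+ 2) ->
  (forall i, (i < size s)%N -> edot (vertex s i - vertex s 0) (edge s i) = 0 \/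
     edot (vertex s i.+1 - vertex s 0) (edge s i) = 0) ->
  convex_arithmetic_polygon s.
Proof.
move=> s2 left len perp; split; last exact: strictly_convex_convex_polygon.
have L i : (i < size s)%N -> side_length s i = (a + i)%:R.
  by move=> ii; apply: enorm_eq (len _ ii).
split=> [|i ii|i ii|i ii|]; first exact: strictly_convex_is_polygon.
- by rewrite L// natr_int.
- by rewrite !L ?(ltnW ii)// addnS -natr1.
- have e0 := strictly_convex_edge_neq0 s2 left i.
  have foot v : edot (v - vertex s 0) (edge s i) = 0 -> exists p d : 'rV[R]_2,
      [/\ d != 0, edot d (edge s i) = 0, line p d (vertex s 0) & line p d v].
    (* When [v] is [O] itself, the joining vector is zero and a quarter turn of the edge gives the
       direction. *)
    move=> h; have [v0|v0] := eqVneq (v - vertex s 0) 0.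
      exists (vertex s 0), (pt (- edge s i 0 1) (edge s i 0 0)); split.
      - apply: contra e0 => /eqP E; apply/eqP/rV2P; rewrite [RHS]mxE.
          by have := pt1 (- edge s i 0 1) (edge s i 0 0); rewrite E mxE.
        have := pt0 (- edge s i 0 1) (edge s i 0 0); rewrite E [LHS]mxE.
        by move/esym/eqP; rewrite oppr_eq0 => /eqP.
      - by rewrite edotE pt0 pt1; ring.
      - by exists 0 => //; rewrite scale0r addr0.
      - by exists 0 => //; rewrite scale0r addr0; apply/esym/eqP; rewrite -subr_eq0 v0.
    exists (vertex s 0), (v - vertex s 0); split=> //.
    - by exists 0 => //; rewrite scale0r addr0.
    - by exists 1 => //; rewrite scale1r subrKC.
  by have [/foot|/foot] := perp i ii => -[p [d [? ? ? ?]]]; exists p, d; split=> //;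
    [left|right].
- by move=> i; exact: strictly_convex_vertex_angle.
Qed.

Definition triangle345 : seq 'rV[R]_2 := [:: pt 0 0; pt 3 0; pt 3 4].

Lemma triangle345_convex_arithmetic : convex_arithmetic_polygon triangle345.
Proof.
apply: (@convex_arithmetic_polygon_intro _ 3) => //.
- move=> [|[|[|?]]] [|[|[|?]]] //= _ _ _ _;
    by rewrite /edge_side /edge /vertex /= !ptB cross_pt; lra.
- by move=> [|[|[|?]]] //= _; rewrite /edge /vertex /= !ptB edot_pt; lra.
- by move=> [|[|[|?]]] //= _; rewrite /edge /vertex /= !ptB !edot_pt;
    [left|left|right]; lra.
Qed.

(** For [l = 12 / sqrt 221] the side lengths are 10 to 14. The last vertex is turned from the
    previous one by an angle of tangent [13 / 14]. *)
Definition pentagon (l : R) : seq 'rV[R]_2 :=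
  let x := 10 - l * 11 in let y := 11 + l * 10 in
  [:: pt 0 0; pt 10 0; pt 10 11; pt x y;
      pt (196 / 365 * (x - 13 / 14 * y)) (196 / 365 * (y + 13 / 14 * x))].

Lemma pentagon_convex_arithmetic :
  convex_arithmetic_polygon (pentagon (12 / Num.sqrt 221)).
Proof.
set l := 12 / _; have l2 : l * l = 144 / 221.
  by rewrite -expr2 expr_div_n sqr_sqrtr; lra.
have l0 : 0 <= l by rewrite divr_ge0// sqrtr_ge0.
(* Rational bounds close enough to [12 / sqrt 221] for the convexity inequalities. *)
have ll : 807 / 1000 < l by nra.
have lu : l < 808 / 1000 by nra.
apply: (@convex_arithmetic_polygon_intro _ 10) => //.
- move=> [|[|[|[|[|?]]]]] [|[|[|[|[|?]]]]] //= _ _ _ _;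
    by rewrite /edge_side /edge /vertex /= !ptB cross_pt; nra.
- by move=> [|[|[|[|[|?]]]]] //= _; rewrite /edge /vertex /= !ptB edot_pt; nra.
- by move=> [|[|[|[|[|?]]]]] //= _; rewrite /edge /vertex /= !ptB !edot_pt;
    [left|left|left|right|right]; nra.
Qed.

End Examples.

(** * Orthonormal frames, possibly reflected *)

Section Frame.
Context {R : realType}.
Implicit Types (s : seq 'rV[R]_2) (o u p q : 'rV[R]_2) (c : R).

Lemma edot_cross_sum u p q :
  edot u p * edot u q + cross u p * cross u q = edot u u * edot p q.
Proof. by rewrite !edotE /cross; ring. Qed.

Lemma edot_cross_diff u p q :
  edot u p * cross u q - cross u p * edot u q = edot u u * cross p q.
Proof. by rewrite !edotE /cross; ring. Qed.

(** Coordinates about [o] with first axis [u], a unit vector; [c = -1] reverses the orientation. *)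
Definition frame o u c p := pt (edot u (p - o)) (c * cross u (p - o)).

Lemma edot_frame o u c p1 p2 q1 q2 : c ^+ 2 = 1 -> edot u u = 1 ->
  edot (frame o u c p1 - frame o u c p2) (frame o u c q1 - frame o u c q2) =
  edot (p1 - p2) (q1 - q2).
Proof.
move=> c2 u1; rewrite -[RHS]mul1r -u1 -edot_cross_sum -[cross u _ * _]mul1r -c2.
by rewrite /frame !ptB edot_pt !edotE /cross !mxE; ring.
Qed.

Lemma cross_frame o u c p1 p2 q1 q2 : edot u u = 1 ->
  cross (frame o u c p1 - frame o u c p2) (frame o u c q1 - frame o u c q2) =
  c * cross (p1 - p2) (q1 - q2).
Proof.
move=> u1; rewrite -[cross (p1 - p2) _]mul1r -u1 -edot_cross_diff.
by rewrite /frame !ptB cross_pt !edotE /cross !mxE; ring.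
Qed.

Lemma frame_rigid o u c : c ^+ 2 = 1 -> edot u u = 1 -> rigid (frame o u c).
Proof. by move=> c2 u1 p q; rewrite /enorm edot_frame. Qed.

Lemma frame_origin o u c : frame o u c o = pt 0 0.
Proof. by rewrite /frame subrr edotE /cross !mxE !mulr0 addr0 subr0 mulr0. Qed.

End Frame.

(** * Reduction of convex arithmetic polygons to coordinates *)

Section Classification.
Context {R : realType} (S : seq 'rV[R]_2).
Context (arithS : arithmetic_polygon S) (convS : convex_polygon S).
Implicit Types (i j : nat).

Let polS : polygon S. Proof. by case: convS. Qed.
Let n0 : (0 < size S)%N := size_polygon_gt0 polS.

Lemma arithmetic_side_length : exists2 a, (0 < a)%N &
  forall i, (i < size S)%N -> enorm (edge S i) = (a + i)%:R.
Proof.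
have [_ intS stepS _ _] := arithS.
have L0 : 0 < enorm (edge S 0) by rewrite enorm_gt0// polygon_edge_neq0.
have : enorm (edge S 0) \is a Num.nat by rewrite natrEint intS//= ltW.
move=> /natrP[a aE]; exists a; first by rewrite -(ltr0n R) -aE.
elim=> [|i IH] ii; first by rewrite addn0.
by rewrite addnS -natr1 -IH ?(ltnW ii)//; exact: stepS.
Qed.

Lemma arithmetic_perp i : (i < size S)%N ->
  edot (vertex S i - vertex S 0) (edge S i) = 0 \/
  edot (vertex S i.+1 - vertex S 0) (edge S i) = 0.
Proof.
have [_ _ _ perpS _] := arithS; move=> /perpS[p [d [d0 de [t _ tE]]]].
have foot x : line p d x -> edot (x - vertex S 0) (edge S i) = 0.
  move=> [r _ <-]; rewrite -tE.
  transitivity ((r - t) * edot d (edge S i)); last by rewrite /edge de mulr0.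
  by rewrite !edotE !mxE; ring.
by case=> /foot; [left|right].
Qed.

(** A vertex lies only on its own two sides; equal to [O] it would also lie on side 0, which leaves
    only the vertex next to [O], distinct by [polygon]. *)
Lemma vertex_neq_origin i : (0 < i < size S)%N -> vertex S i != vertex S 0.
Proof.
case: i => // i /andP[_ ii]; apply/eqP => E.
have simS : simple_polygon S by case: convS.
have s0 : side S 0 (vertex S i.+1) by rewrite E; exact: side_left.
have [/eqP|/eqP] := vertex_side polS simS s0; rewrite !modn_small ?(ltnW ii)//.
by move=> /eqP i0; have [_ /(_ 0)] := polS; rewrite -E -i0 eqxx.
Qed.

(** The frame has origin [O] and first axis along the first side, and [c] reflects a clockwise
    polygon; the coordinates then satisfy the hypotheses on paths. *)
Lemma convex_arithmetic_congruent :
  congruent S triangle345 \/ congruent S (pentagon (12 / Num.sqrt 221)).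
Proof.
have angS : forall i, (i < size S)%N -> vertex_angle S i != 0 /\ vertex_angle S i != pi.
  by case: arithS.
have [a a0 len] := arithmetic_side_length.
have [c [c2 turnc leftc]] := convex_polygon_orientation convS angS.
have s2 : (2 < size S)%N by case: polS.
have aR : 0 < a%:R :> R by rewrite ltr0n.
pose u := a%:R^-1 *: edge S 0.
have e00 : edot (edge S 0) (edge S 0) = a%:R ^+ 2.
  by rewrite -sqr_enorm len// addn0.
have u1 : edot u u = 1.
  have -> : edot u u = a%:R ^- 2 * edot (edge S 0) (edge S 0).
    by rewrite /u !edotE !mxE; field; rewrite gt_eqF.
  by rewrite e00 mulVf// expf_neq0// gt_eqF.
pose f := frame (vertex S 0) u c.
have f_rigid : rigid f by exact: frame_rigid.
pose X i : R := f (vertex S i) 0 0; pose Y i : R := f (vertex S i) 0 1.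
have f0 : f (vertex S 0) = pt 0 0 by exact: frame_origin.
have f1 : f (vertex S 1) = pt a%:R 0.
  rewrite /f /frame -/(edge S 0) /u crossZl crossvv mulr0 mulr0; congr pt.
  transitivity (a%:R^-1 * edot (edge S 0) (edge S 0)).
    by rewrite !edotE !mxE; ring.
  by rewrite e00; field; rewrite gt_eqF.
have subE (p q : 'rV[R]_2) (j : 'I_2) : (p - q) 0 j = p 0 j - q 0 j by rewrite !mxE.
have dotf i j k l : (X i - X j) * (X k - X l) + (Y i - Y j) * (Y k - Y l) =
    edot (vertex S i - vertex S j) (vertex S k - vertex S l).
  by rewrite -(edot_frame (vertex S 0) _ _ _ _ c2 u1) edotE !subE.
have crossf i j k l : (X i - X j) * (Y k - Y l) - (Y i - Y j) * (X k - X l) =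
    c * cross (vertex S i - vertex S j) (vertex S k - vertex S l).
  by rewrite -(cross_frame (vertex S 0) c _ _ _ _ u1) /cross !subE.
have X0 : X 0 = 0 by rewrite /X f0 pt0.
have Y0 : Y 0 = 0 by rewrite /Y f0 pt1.
have fE i : f (vertex S i) = pt (X i) (Y i).
  by apply: rV2P; [rewrite [RHS]pt0|rewrite [RHS]pt1].
have nthE i : (i < size S)%N -> S`_i = vertex S i.
  by move=> ii; rewrite /vertex modn_small.
have [||||||||||||||[nE X1 Y1 X2 Y2]|[nE X1 Y1 [X2 Y2] [X3 Y3 X4 Y4]]] :=
    @arithmetic_path_classification R (size S) a X Y.
- exact: a0.
- exact: s2.
- exact: X0.
- exact: Y0.
- by rewrite /X -[size S]add0n vertex_size f0 pt0.
- by rewrite /Y -[size S]add0n vertex_size f0 pt1.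
- by rewrite /X f1 pt0.
- by rewrite /Y f1 pt1.
- by move=> i ii; rewrite !expr2 dotf -sqr_enorm len.
- move=> i ii; have := dotf i 0 i.+1 i; have := dotf i.+1 0 i.+1 i.
  by rewrite X0 Y0 !subr0 => -> ->; exact: arithmetic_perp.
- by move=> i _; rewrite crossf; exact/lt0r_neq0/turnc.
- move=> i ii; have := dotf i 0 i 0; rewrite X0 Y0 !subr0 -!expr2 => ->.
  by rewrite edot_gt0// subr_eq0 vertex_neq_origin.
(* Nonnegative heights express one-sidedness with respect to side 0. *)
- move=> i _; have := leftc 0 i; rewrite /Y /f /frame pt1 /u crossZl mulrCA.
  by move=> h; rewrite mulr_ge0// invr_ge0.
(* Counterclockwise motion about [O] is one-sidedness of side [i], tested at [O]. *)
- move=> i _; have := crossf i 0 i.+1 0; rewrite X0 Y0 !subr0 => ->.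
  have := leftc i 0; rewrite /edge_side /edge.
  by congr (0 <= c * _); rewrite /cross !mxE; ring.
- left; exists f => //; apply: (@eq_from_nth _ 0) => [|i]; rewrite size_map ?nE// => ii.
  rewrite (nth_map 0) ?nE// nthE ?nE// fE.
  by move: ii; case: i => [|[|[|//]]] _; rewrite ?X0 ?Y0 ?X1 ?Y1 ?X2 ?Y2.
- right; exists f => //; apply: (@eq_from_nth _ 0) => [|i]; rewrite size_map ?nE// => ii.
  rewrite (nth_map 0) ?nE// nthE ?nE// fE; rewrite X3 Y3 in X4 Y4.
  by move: ii; case: i => [|[|[|[|[|//]]]]] _;
    rewrite ?X0 ?Y0 ?X1 ?Y1 ?X2 ?Y2 ?X3 ?Y3 ?X4 ?Y4.
Qed.

End Classification.

Theorem theorem1p6 (R : realType) :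
  exists P Q : seq 'rV[R]_2,
    [/\ convex_arithmetic_polygon P, convex_arithmetic_polygon Q,
        ~ congruent P Q
      & forall S : seq 'rV[R]_2, convex_arithmetic_polygon S ->
          congruent S P \/ congruent S Q].
Proof.
exists triangle345, (pentagon (12 / Num.sqrt 221)); split.
- exact: triangle345_convex_arithmetic.
- exact: pentagon_convex_arithmetic.
(* Congruence preserves the number of vertices, here 3 and 5. *)
- by move=> [f _ /(congr1 size)].
- by move=> S [arithS convS]; exact: convex_arithmetic_congruent.
Qed.
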